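(* Let $n\ge 1$ and $k$ be integers with $0\le k<n$. (Real case) Let $M$ be a $\mathcal C^2$-smooth convex hypersurface in $\mathbb R^{n+1}$ and let $p\in M$. Then the following are equivalent: (i) there is a neighborhood $V$ of $p$ in $M$ such that for every $q\in V$ the rank of the second fundamental form of $M$ at $q$ is at most $k$; (ii) there is a neighborhood $V'$ of $p$ in $M$ such that for every $q\in V'$ there exists a real $(n-k)$-dimensional plane through $q$ that locally lies on $M$. (Complex case) Let $M$ be a $\mathcal C^2$-smooth convex (real) hypersurface in $\mathbb C^{n+1}$ and let $p\in M$. Then the following are equivalent: (i) there is a neighborhood $V$ of $p$ in $M$ such that for every $q\in V$ the rank of the Levi form of $M$ at $q$ is at most $k$; (ii) there is a neighborhood $V'$ of $p$ in $M$ such that for every $q\in V'$ there exists a complex $(n-k)$-dimensional plane through $q$ that locally lies on $M$.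
   Context: A hypersurface $M$ in $\mathbb R^{n+1}$ (respectively a real hypersurface in $\mathbb C^{n+1}\cong\mathbb R^{2n+2}$) is called convex if it is a (relatively open) part of the boundary of a convex domain, i.e. of a nonempty open convex set. A real (respectively complex) $m$-dimensional plane is a real (respectively complex) affine subspace of real (respectively complex) dimension $m$. A plane $\Pi$ through $q\in M$ locally lies on $M$ if there is a neighborhood $U$ of $q$ in the ambient space such that $\Pi\cap U\subset M$. If $r$ is a $\mathcal C^2$ local defining function of $M$ near $q$ (so $M=\{r=0\}$ near $q$ and $dr\neq 0$ on $M$), then, up to a nonzero factor (which does not affect the rank), the second fundamental form of $M\subset\mathbb R^{n+1}$ at $q$ is the restriction of the Hessian quadratic form $\sum_{i,j}\frac{\partial^2 r}{\partial x_i\partial x_j}(q)X_iX_j$ to the $n$-dimensional tangent space $T_qM$. Likewise, the Levi form of $M\subset\mathbb C^{n+1}$ at $q$ is, up to a nonzero factor, the restriction of the Hermitian form $\sum_{i,j}\frac{\partial^2 r}{\partial z_i\partial\bar z_j}(q)X_i\overline{X_j}$ to the complex tangent space $T_q^{\mathbb C}M=\{X\in\mathbb C^{n+1}:\sum_j\frac{\partial r}{\partial z_j}(q)X_j=0\}$, which has complex dimension $n$; its rank is the complex rank of this Hermitian form. *)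

(* Defs.v *)
From HB Require Import structures.
From mathcomp Require Import all_boot all_order all_algebra.
From mathcomp Require Import all_classical all_reals all_analysis.
From mathcomp Require Import complex.

Set Implicit Arguments.
Unset Strict Implicit.
Unset Printing Implicit Defensive.

Import Order.TTheory GRing.Theory Num.Theory.
Import numFieldNormedType.Exports.

Local Open Scope classical_set_scope.
Local Open Scope ring_scope.
Local Open Scope complex_scope.

Definition boundary (T : topologicalType) (A : set T) : set T :=
  closure A `\` interior A.

Section affine.
Variables (K : fieldType) (N : nat).

Definition affine_plane (m : nat) (P : set 'rV[K]_N) : Prop :=
  exists (a : 'rV[K]_N) (A : {vspace 'rV[K]_N}),
    \dim A = m /\ P = [set x | x - a \in A].

End affine.

Section real.
Variables (R : realType) (N : nat).
Local Notation E := 'rV[R]_N.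

Definition evec (i : 'I_N) : E := delta_mx 0 i.

Definition partial (i : 'I_N) (f : E -> R) : E -> R := 'D_(evec i) f.

Definition C1_on (U : set E) (f : E -> R) : Prop :=
  forall x, U x -> {for x, continuous f} /\
    forall i, derivable f x (evec i) /\ {for x, continuous (partial i f)}.

Definition C2_on (U : set E) (f : E -> R) : Prop :=
  C1_on U f /\ forall i, C1_on U (partial i f).

Definition gradient (f : E -> R) (x : E) : 'cV[R]_N :=
  \col_i partial i f x.

Definition hessian (f : E -> R) (x : E) : 'M[R]_N :=
  \matrix_(i, j) partial i (partial j f) x.

Definition local_defining (M : set E) (q : E) (r : E -> R) : Prop :=
  exists U : set E, [/\ open_nbhs q U, C2_on U r,
    forall x, U x -> (M x <-> r x = 0) &
    forall x, U x -> M x -> gradient r x != 0].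

Definition C2_hypersurface (M : set E) : Prop :=
  forall q, M q -> exists r, local_defining M q r.

Definition convex_hypersurface (M : set E) : Prop :=
  exists D : set E, [/\ D !=set0, open D, convex_set D &
    exists2 W : set E, open W & M = W `&` boundary D].

(* The rows of the matrix B form a basis of T_q M = {X | X *m gradient r q = 0},
   so this is the rank of the Gram matrix of the Hessian form in that basis. *)
Definition second_form_rank (r : E -> R) (q : E) : nat :=
  let B := row_base (kermx (gradient r q)) in
  \rank (B *m hessian r q *m B^T).

(* The rank does not depend on the local defining function: changing it only
   multiplies the restricted form by a nonzero factor. *)
Definition second_form_rank_le (M : set E) (q : E) (k : nat) : Prop :=
  forall r, local_defining M q r -> (second_form_rank r q <= k)%N.

Definition real_locally_lies (M : set E) (q : E) (P : set E) : Prop :=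
  exists2 U : set E, nbhs q U & P `&` U `<=` M.

End real.

(* The point z of C^m is encoded by the vector w = (x, y) of R^(m + m) with
   z_j = x_j + i y_j; cvec w is then z. *)
Section complex.
Variables (R : realType) (m : nat).
Local Notation C := R[i].
Local Notation E := 'rV[R]_(m + m).

Definition cvec (w : E) : 'rV[C]_m :=
  \row_j (w 0 (lshift m j) +i* w 0 (rshift m j)).

Definition cpartial (i : 'I_(m + m)) (f : E -> C) : E -> C :=
  fun w => partial i (fun u => complex.Re (f u)) w
           +i* partial i (fun u => complex.Im (f u)) w.

Definition dz (j : 'I_m) (f : E -> C) : E -> C := fun w =>
  (cpartial (lshift m j) f w - (0 +i* 1) * cpartial (rshift m j) f w) / 2%:R.

Definition dzbar (j : 'I_m) (f : E -> C) : E -> C := fun w =>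
  (cpartial (lshift m j) f w + (0 +i* 1) * cpartial (rshift m j) f w) / 2%:R.

Definition cgradient (r : E -> R) (w : E) : 'cV[C]_m :=
  \col_j dz j (fun u => (r u)%:C) w.

Definition levi_mx (r : E -> R) (w : E) : 'M[C]_m :=
  \matrix_(i, j) dz i (dzbar j (fun u => (r u)%:C)) w.

(* The rows of B form a basis of the complex tangent space
   {X | X *m cgradient r q = 0}. *)
Definition levi_rank (r : E -> R) (q : E) : nat :=
  let B := row_base (kermx (cgradient r q)) in
  \rank (B *m levi_mx r q *m (map_mx conjc B)^T).

Definition levi_rank_le (M : set E) (q : E) (k : nat) : Prop :=
  forall r, local_defining M q r -> (levi_rank r q <= k)%N.

Definition complex_locally_lies (M : set E) (q : E) (P : set 'rV[C]_m) : Prop :=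
  real_locally_lies M q (cvec @^-1` P).

End complex.

(* Main.v *)
(** Idea.  (ii) => (i): the restricted Hessian form is semidefinite by convexity
and vanishes on the direction of a plane lying on M, so this direction is in its
kernel; in the complex case the same is applied to H(w,w) + H(Jw,Jw), which is
four times the real part of the Levi form.

(i) => (ii): let V be the space of all v such that a segment centred at q in
direction v lies in the closure of the convex domain D.  If V (in the complex
case V intersected with iV) is too small, there is a quadratic form Q, positive definite on V,
such that -Q (in the complex case its Levi part) is positive definite on a
subspace L so large that it meets every tangent space in dimension > k.  A
separation argument gives a linear form a such that phi = delta + a - Q, which
is positive at q, is negative at all points of the closure of D which lie in the
supporting hyperplane nu = 0 and at a fixed small distance from q.  For small
eps the function nu - eps * phi then attains its minimum over the closure of D
near q at some x in M, and the second order condition at x makes the second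
fundamental form definite on the trace of L on T_x M: its rank exceeds k. *)

Require Import Defs.
From HB Require Import structures.
From mathcomp Require Import all_boot all_order all_algebra.
From mathcomp Require Import all_classical all_reals all_analysis.
From mathcomp Require Import complex.
From mathcomp Require Import ring lra zify.

Set Implicit Arguments.
Unset Strict Implicit.
Unset Printing Implicit Defensive.

Import Order.TTheory GRing.Theory Num.Theory.
Import numFieldNormedType.Exports.

Local Open Scope classical_set_scope.
Local Open Scope ring_scope.
Local Open Scope complex_scope.

(** * Derivatives along lines; linear and quadratic forms *)

Section derivatives.
Variable R : realType.

(** A rank bound at q alone does not flatten M near q (the graph of x^4 at 0), so the bound has to
    be tested at nearby points x. As M is only C2, the kernels of the forms vary at best
    continuously; instead of integrating them into leaves, the proof uses convexity and a minimum.

    The linear form a is there because q may lie on the relative boundary of the face of the closure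
    of D in nu = 0. Q controls only the two-sided directions of this face, which form V; a takes
    care of the one-sided ones. Since phi is positive at q, nu - eps * phi is negative there; for
    small eps it is positive on the small sphere about q, and nu dominates its derivative, so the
    minimum lies neither on the sphere nor in D.

    First and second order conditions on M come from points q + t X + s t^2 e of M, where e has
    derivative 1 under the defining function. Only the limit of s as t tends to 0 matters, so M is
    never parametrized. *)

Lemma is_derive_epsP (V : normedModType R) (f : V -> R) (x v : V) (d : R) :
  is_derive x v f d <->
  (forall e : R, 0 < e -> exists2 del : R, 0 < del &
    forall h : R, `|h| < del -> `|f (x + h *: v) - f x - d * h| <= e * `|h|).
Proof.
(* Cleared of the division by [h], the bound also makes sense at [h = 0], so no punctured
   neighbourhood appears later. *)
have key (e h A : R) : h != 0 ->
    (`|d - h^-1 *: A| <= e) = (`|A - d * h| <= e * `|h|).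
  move=> h0; rewrite -(@ler_pM2r _ `|h|) ?normr_gt0// -normrM distrC.
  by congr (`| _ | <= _); rewrite mulrBl [_ *: _]mulrC divfK.
split=> [[df dv] e e0|H].
- move: df; rewrite /derivable -/(derive f x v) => df.
  have : (fun h : R => h^-1 *: ((f \o shift x) (h *: v) - f x)) @ 0^' --> d.
    by rewrite -dv.
  move=> /cvgrPdist_le /(_ e e0).
  rewrite near_withinE => /nbhs_ballP[del /= del0 Hdel].
  exists del => // h hdel.
  have [->|hn0] := eqVneq h 0.
    by rewrite scale0r addr0 subrr mulr0 subrr normr0 mulr0.
  have := Hdel h _ hn0; rewrite /= -ball_normE /= sub0r normrN => /(_ hdel).
  by rewrite key// [_ + x]addrC.
- have H' : (fun h : R => h^-1 *: ((f \o shift x) (h *: v) - f x)) @ 0^' --> d.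
    apply/cvgrPdist_le => e e0; have [del del0 Hdel] := H e e0.
    rewrite near_withinE; apply/nbhs_ballP; exists del => //= h.
    rewrite -ball_normE /= sub0r normrN => hdel hn0.
    by rewrite key// [_ + x]addrC; exact: Hdel.
  split; last exact: (cvg_lim _ H').
  by apply/cvg_ex; exists d.
Qed.

Lemma is_derive_line (V : normedModType R) (f : V -> R) (y v : V) (t d : R) :
  is_derive (y + t *: v) v f d ->
  is_derive t (1 : R) (fun s : R => f (y + s *: v)) d.
Proof.
move=> /is_derive_epsP H; apply/is_derive_epsP => e /H [del del0 Hdel].
exists del => // h /Hdel; congr (_ <= _); congr (`| f _ - _ - _|).
by rewrite [_ *: 1]mulr1 scalerDl addrA.
Qed.

Lemma is_deriveZv (V : normedModType R) (f : V -> R) (x v : V) (c d : R) :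
  is_derive x v f d -> is_derive x (c *: v) f (c * d).
Proof.
move=> /is_derive_epsP H; apply/is_derive_epsP => e e0.
(* Dividing by [|c| + 1] covers the case [c = 0]. *)
have c0 : 0 < `|c| + 1 by rewrite ltr_pwDr.
have [del del0 Hdel] := H (e / (`|c| + 1)) (divr_gt0 e0 c0).
exists (del / (`|c| + 1)) => [|h hdel]; first exact: divr_gt0.
have hc : `|h * c| < del.
  rewrite normrM; move: hdel; rewrite ltr_pdivlMr//; apply: le_lt_trans.
  by rewrite ler_wpM2l// lerDl.
have := Hdel _ hc; rewrite scalerA (_ : d * (h * c) = c * d * h); last by ring.
move=> /le_trans; apply; rewrite normrM mulrAC ler_pdivrMr// -mulrA.
by rewrite ler_wpM2l ?(ltW e0)// ler_wpM2l// lerDl.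
Qed.

Lemma MVT01 (g dg : R -> R) :
  (forall t : R, 0 <= t <= 1 -> is_derive t (1 : R) g (dg t)) ->
  exists2 c, 0 <= c <= 1 & g 1 - g 0 = dg c.
Proof.
move=> Hg.
have [||c] := @MVT R g dg 0 1 ltr01.
- by move=> x; rewrite in_itv/= => /andP[x0 x1]; apply: Hg; rewrite !ltW.
- apply: derivable_within_continuous => x; rewrite in_itv/= => /Hg.
  by case.
rewrite in_itv/= => /andP[c0 c1]; rewrite subr0 mulr1 => gc.
by exists c; rewrite // !ltW.
Qed.

End derivatives.

Section forms.
Variables (R : realType) (N : nat).
Local Notation E := 'rV[R]_N.
Implicit Types (x y : E) (l : 'cV[R]_N) (G : 'M[R]_N).

Definition lin l x : R := (x *m l) 0 0.
Definition form G x y : R := (x *m G *m y^T) 0 0.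

Lemma linE l x : lin l x = \sum_i x 0 i * l i 0.
Proof. by rewrite /lin mxE. Qed.

Lemma linD l x y : lin l (x + y) = lin l x + lin l y.
Proof. by rewrite /lin mulmxDl mxE. Qed.

Lemma linZ l (a : R) x : lin l (a *: x) = a * lin l x.
Proof. by rewrite /lin -scalemxAl mxE. Qed.

Lemma linN l x : lin l (- x) = - lin l x.
Proof. by rewrite -scaleN1r linZ mulN1r. Qed.

Lemma linB l x y : lin l (x - y) = lin l x - lin l y.
Proof. by rewrite linD linN. Qed.

Lemma lin0 l : lin l 0 = 0.
Proof. by rewrite /lin mul0mx mxE. Qed.

Lemma linlZ (a : R) l x : lin (a *: l) x = a * lin l x.
Proof. by rewrite /lin -scalemxAr mxE. Qed.

Lemma linlN l x : lin (- l) x = - lin l x.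
Proof. by rewrite -scaleN1r linlZ mulN1r. Qed.

Lemma lin_eq0 l x : (x *m l = 0) <-> (lin l x = 0).
Proof.
rewrite /lin; split=> [->|H]; first by rewrite mxE.
by apply/matrixP => i j; rewrite !ord1 H mxE.
Qed.

Lemma formE G x y : form G x y = \sum_i x 0 i * \sum_j G i j * y 0 j.
Proof.
rewrite /form -mulmxA mxE; apply: eq_bigr => i _; rewrite mxE.
by congr (_ * _); apply: eq_bigr => j _; rewrite mxE.
Qed.

Lemma formDl G x y z : form G (x + y) z = form G x z + form G y z.
Proof. by rewrite /form !mulmxDl mxE. Qed.

Lemma formDr G x y z : form G x (y + z) = form G x y + form G x z.
Proof. by rewrite /form linearD mulmxDr mxE. Qed.

Lemma formZl G (a : R) x y : form G (a *: x) y = a * form G x y.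
Proof. by rewrite /form -!scalemxAl mxE. Qed.

Lemma formZr G (a : R) x y : form G x (a *: y) = a * form G x y.
Proof. by rewrite /form linearZ -scalemxAr mxE. Qed.

Lemma form0l G y : form G 0 y = 0.
Proof. by rewrite /form !mul0mx mxE. Qed.

Lemma formNr G x y : form G x (- y) = - form G x y.
Proof. by rewrite -scaleN1r formZr mulN1r. Qed.

Lemma form_sym G x y : G^T = G -> form G x y = form G y x.
Proof.
move=> sG; have E : y *m G *m x^T = (x *m G *m y^T)^T.
  by rewrite !trmx_mul trmxK sG mulmxA.
by rewrite /form E [RHS]mxE.
Qed.

Lemma ler_coord_norm m n (A : 'M[R]_(m, n)) i j : `|A i j| <= `|A|.
Proof.
rewrite [leRHS]/Num.norm /= mx_normrE; apply/bigmax_geP; right.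
by exists (i, j).
Qed.

Lemma ler_norm_coord m n (A : 'M[R]_(m, n)) e : 0 <= e ->
  (forall i j, `|A i j| <= e) -> `|A| <= e.
Proof.
move=> e0 H; rewrite [leLHS]/Num.norm /= mx_normrE; apply/bigmax_leP; by split.
Qed.

Lemma lin_bound l : exists2 c : R, 0 < c & forall x, `|lin l x| <= c * `|x|.
Proof.
exists (1 + \sum_i `|l i 0|) => [|x]; first by rewrite ltr_pwDl// sumr_ge0.
rewrite mulrDl mul1r; apply: ler_wpDl; first exact: normr_ge0.
rewrite linE (le_trans (ler_norm_sum _ _ _))// mulr_suml ler_sum// => i _.
by rewrite normrM mulrC ler_wpM2l// ler_coord_norm.
Qed.

Lemma form_bound G : exists2 c : R, 0 < c &
  forall x y, `|form G x y| <= c * (`|x| * `|y|).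
Proof.
exists (1 + \sum_i \sum_j `|G i j|) => [|x y].
  by rewrite ltr_pwDl// sumr_ge0// => i _; rewrite sumr_ge0.
rewrite mulrDl mul1r; apply: ler_wpDl; first exact: mulr_ge0.
rewrite formE (le_trans (ler_norm_sum _ _ _))// mulr_suml ler_sum// => i _.
rewrite normrM mulrCA ler_pM ?ler_coord_norm//.
rewrite (le_trans (ler_norm_sum _ _ _))// mulr_suml ler_sum// => j _.
by rewrite normrM ler_wpM2l// ler_coord_norm.
Qed.

Lemma continuous_sumR (T : topologicalType) (I : Type) (r : seq I)
    (F : I -> T -> R) :
  (forall i, continuous (F i)) -> continuous (fun t => \sum_(i <- r) F i t).
Proof.
move=> cF; elim: r => [|i r IH] t.
  under eq_fun do rewrite big_nil; exact: cvg_cst.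
under eq_fun do rewrite big_cons; apply: cvgD; [exact: cF | exact: IH].
Qed.

Lemma continuous_mulR (T : topologicalType) (f g : T -> R) :
  continuous f -> continuous g -> continuous (fun t => f t * g t).
Proof. by move=> cf cg t; apply: (@cvgM R T (nbhs t) _ f g); [exact: cf|exact: cg]. Qed.

Lemma continuous_cstR (T : topologicalType) (a : R) :
  continuous (fun _ : T => a).
Proof. by move=> t; exact: cvg_cst. Qed.

Lemma continuous_coord i : continuous (fun x : E => x 0 i).
Proof. by move=> x; apply: coord_continuous. Qed.

Lemma lin_continuous l : continuous (lin l).
Proof.
rewrite (_ : lin l = fun x => \sum_i x 0 i * l i 0); last first.
  by apply/funext => x; rewrite linE.
apply: continuous_sumR => i; apply: continuous_mulR; first exact: continuous_coord.
exact: continuous_cstR.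
Qed.

Lemma form_continuous G : continuous (fun x => form G x x).
Proof.
rewrite (_ : (fun x => _) = fun x => \sum_i x 0 i * \sum_j G i j * x 0 j); last first.
  by apply/funext => x; rewrite formE.
apply: continuous_sumR => i; apply: continuous_mulR; first exact: continuous_coord.
apply: continuous_sumR => j; apply: continuous_mulR; last exact: continuous_coord.
exact: continuous_cstR.
Qed.

End forms.

Lemma nbhs_addP (R : realType) (V : normedModType R) (x : V) (A : set V) :
  nbhs x A <-> exists2 del : R, 0 < del & forall h, `|h| < del -> A (x + h).
Proof.
split=> [/nbhs_ballP[del /= del0 H]|[del del0 H]].
  exists del => // h hd; apply: H; rewrite -ball_normE /=.
  by rewrite opprD addrA subrr add0r normrN.
apply/nbhs_ballP; exists del => //= y; rewrite -ball_normE /= => yx.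
by rewrite -(subrK x y) addrC; apply: H; rewrite distrC.
Qed.

(** * Taylor expansions of order one and two *)

Section taylor.
Variables (R : realType) (N : nat).
Local Notation E := 'rV[R]_N.
Implicit Types (x y h : E) (U : set E) (f : E -> R).

Lemma evecE (i j : 'I_N) : evec R i 0 j = (i == j)%:R.
Proof. by rewrite mxE eqxx eq_sym. Qed.

Lemma lin_evec (l : 'cV[R]_N) i : lin l (evec R i) = l i 0.
Proof.
rewrite linE (bigD1 i) //= big1 => [|j ji]; rewrite evecE.
  by rewrite eqxx mul1r addr0.
by rewrite eq_sym (negPf ji) mul0r.
Qed.

Lemma lin_gradient f x h :
  lin (gradient f x) h = \sum_i h 0 i * partial i f x.
Proof. by rewrite linE; apply: eq_bigr => i _; rewrite mxE. Qed.

Lemma form_hessian f x h :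
  form (hessian f x) h h = \sum_j h 0 j * lin (gradient (partial j f) x) h.
Proof.
rewrite formE; under eq_bigr do rewrite mulr_sumr.
rewrite exchange_big /=; apply: eq_bigr => j _.
rewrite lin_gradient mulr_sumr; apply: eq_bigr => i _.
by rewrite mxE mulrCA mulrA [LHS]mulrC mulrA mulrAC -mulrA mulrC -!mulrA.
Qed.

(** The corners of the path from 0 to [h] that changes one coordinate at a time. *)
Definition trunc (k : nat) h : E := \row_i (if (i < k)%N then h 0 i else 0).

(** [C1_on] speaks of partial derivatives only. Total differentiability follows from the mean value
    theorem on each edge of the coordinate path: the [N] errors are at most [e' * |h|] each. *)
Lemma C1_taylor U f x : open U -> C1_on U f -> U x ->
  forall e : R, 0 < e -> exists2 del : R, 0 < del & forall h, `|h| < del ->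
    U (x + h) /\ `|f (x + h) - f x - lin (gradient f x) h| <= e * `|h|.
Proof.
move=> oU Cf Ux e e0.
pose e' := e / N.+1%:R.
have e'0 : 0 < e' by rewrite divr_gt0.
have nU : nbhs x U by exact: open_nbhs_nbhs.
have nP : nbhs x [set y | forall i, `|partial i f y - partial i f x| <= e'].
  apply: (@filter_forall E 'I_N (fun i y => `|partial i f y - partial i f x| <= e')
    (nbhs x) _).
  move=> i; have [_ /(_ i)[_ ci]] := Cf x Ux.
  by have /cvgrPdist_le/(_ _ e'0) := ci; apply: filterS => y; rewrite distrC.
have [del del0 Hdel] := (@nbhs_addP R E x _).1 (filterI nU nP).
exists del => // h hd; split; first by have [] := Hdel h hd.
(* The norm is the sup norm, so no point of the path is farther from [x] than [x + h]. *)
have tr_le k (c : R) (i : 'I_N) : 0 <= c <= 1 -> i = k :> nat ->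
    `|trunc k h + c *: (h 0 i *: evec R i)| < del.
  move=> /andP[c0 c1] ik; apply: le_lt_trans hd; apply: ler_norm_coord => // a j.
  rewrite (ord1 a) !mxE eqxx /=; case: ltngtP => [jk|jk|jk].
  - have -> : (j == i) = false by apply/eqP => ji; rewrite ji ik ltnn in jk.
    by rewrite mulr0 mulr0 addr0 ler_coord_norm.
  - have -> : (j == i) = false by apply/eqP => ji; rewrite ji ik ltnn in jk.
    by rewrite !mulr0 addr0 normr0.
  - have -> : j = i by apply/val_inj; rewrite /= jk ik.
    rewrite eqxx mulr1 add0r normrM (ger0_norm c0).
    by rewrite (le_trans _ (ler_coord_norm h 0 i))// ler_piMl.
suff H k : (k <= N)%N -> `|f (x + trunc k h) - f x -
    \sum_(i < N | (i < k)%N) h 0 i * partial i f x| <= k%:R * (e' * `|h|).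
  have := H N (leqnn N).
  have -> : trunc N h = h by apply/rowP => i; rewrite mxE ltn_ord.
  rewrite lin_gradient (eq_bigl xpredT) => [|i]; last by rewrite ltn_ord.
  move=> /le_trans; apply; rewrite mulrA ler_wpM2r// /e' mulrCA ger_pMr//.
  by rewrite ler_pdivrMr// mul1r ler_nat.
elim: k => [_|k IH kN].
  have -> : trunc 0 h = 0 by apply/rowP => i; rewrite !mxE.
  by rewrite addr0 big_pred0// subr0 subrr normr0 mul0r.
pose i := Ordinal kN.
have trS : trunc k.+1 h = trunc k h + 1 *: (h 0 i *: evec R i).
  apply/rowP => j; rewrite !mxE eqxx mul1r /= ltnS leq_eqVlt.
  have -> : (j == i) = (j == k :> nat) by [].
  case: eqP => [jk|_]; last by rewrite mulr0 addr0.
  by rewrite /= jk ltnn add0r mulr1; congr (h 0 _); exact/val_inj.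
have [|c c01 Hc] := @MVT01 R (fun t => f (x + trunc k h + t *: (h 0 i *: evec R i)))
    (fun t => h 0 i * partial i f (x + trunc k h + t *: (h 0 i *: evec R i))).
  move=> t t01; apply: is_derive_line; apply: is_deriveZv; apply: DeriveDef => //.
  have [Uz _] := Hdel _ (tr_le k t i t01 erefl); rewrite addrA in Uz.
  by have [_ /(_ i)[]] := Cf _ Uz.
have := IH (ltnW kN); set S1 := \sum_(_ < _ | _) _ => IHk.
have -> : \sum_(j < N | (j < k.+1)%N) h 0 j * partial j f x =
    h 0 i * partial i f x + S1.
  rewrite (bigD1 i) /=; last exact: ltnSn.
  congr (_ + _); apply: eq_bigl => j; rewrite ltnS -val_eqE /=.
  by rewrite ltn_neqAle andbC.
rewrite scale0r addr0 -[in X in X = _]addrA -trS in Hc.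
  have -> : f (x + trunc k.+1 h) - f x - (h 0 i * partial i f x + S1) =
     (f (x + trunc k h) - f x - S1) + h 0 i *
     (partial i f (x + trunc k h + c *: (h 0 i *: evec R i)) - partial i f x).
    rewrite mulrBr -Hc; ring.
  rewrite -[k.+1]addn1 natrD mulrDl mul1r (le_trans (ler_normD _ _))// lerD//.
  rewrite normrM mulrC ler_pM// ?ler_coord_norm//.
  by rewrite -addrA; have [_ /(_ i)] := Hdel _ (tr_le k c i c01 erefl).
Qed.

Lemma C1_is_derive U f x v : open U -> C1_on U f -> U x ->
  is_derive x v f (lin (gradient f x) v).
Proof.
move=> oU Cf Ux; apply/is_derive_epsP => e e0.
have v0 : 0 < `|v| + 1 by rewrite ltr_pwDr.
have [del del0 H] := C1_taylor oU Cf Ux (divr_gt0 e0 v0).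
exists (del / (`|v| + 1)) => [|t td]; first exact: divr_gt0.
have tv : `|t *: v| < del.
  rewrite normrZ; move: td; rewrite ltr_pdivlMr//; apply: le_lt_trans.
  by rewrite ler_wpM2l// lerDl.
have [_] := H _ tv; rewrite linZ mulrC => /le_trans; apply.
rewrite normrZ mulrAC ler_pdivrMr// -mulrA ler_wpM2l ?(ltW e0)//.
by rewrite ler_wpM2l// lerDl.
Qed.

Lemma C1_line U f x v t : open U -> C1_on U f -> U (x + t *: v) ->
  is_derive t (1 : R) (fun s => f (x + s *: v)) (lin (gradient f (x + t *: v)) v).
Proof. by move=> oU Cf Ux; apply: is_derive_line; exact: C1_is_derive Ux. Qed.

(** Subtracting the quadratic polynomial along the segment leaves a function [g] of one variable.
    Its derivative is the first order Taylor error of the partial derivatives contracted with [h],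
    so one use of the mean value theorem suffices. *)
Lemma C2_taylor U f x : open U -> C2_on U f -> U x ->
  forall e : R, 0 < e -> exists2 del : R, 0 < del & forall h, `|h| < del ->
    U (x + h) /\ `|f (x + h) - f x - lin (gradient f x) h
       - 2^-1 * form (hessian f x) h h| <= e * `|h| ^+ 2.
Proof.
move=> oU [Cf Cpf] Ux e e0.
pose e' := e / N.+1%:R.
have e'0 : 0 < e' by rewrite divr_gt0.
have nP : nbhs x [set y | forall i, U y /\
    `|partial i f y - partial i f x - lin (gradient (partial i f) x) (y - x)|
      <= e' * `|y - x|].
  apply: (@filter_forall E 'I_N (fun i y => U y /\
    `|partial i f y - partial i f x - lin (gradient (partial i f) x) (y - x)|
      <= e' * `|y - x|) (nbhs x) _) => i.
  apply/(@nbhs_addP R E); have [del del0 H] := C1_taylor oU (Cpf i) Ux e'0.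
  by exists del => // h /H; rewrite [x + h - x]addrAC subrr add0r.
have nU : nbhs x U by exact: open_nbhs_nbhs.
have [del del0 Hdel] := (@nbhs_addP R E x _).1 (filterI nU nP).
exists del => // h hd; split; first by have [] := Hdel h hd.
have th t : 0 <= t <= 1 -> `|t *: h| <= `|h|.
  by move=> /andP[t0 t1]; rewrite normrZ ger0_norm// ler_piMl.
pose L := lin (gradient f x) h; pose H2 := form (hessian f x) h h.
pose g t := f (x + t *: h) - L * t - 2^-1 * H2 * (t * t).
have [|c c01] := @MVT01 R g (fun t => lin (gradient f (x + t *: h)) h - L - H2 * t).
  move=> t t01; rewrite /g.
  have [Uz _] := Hdel _ (le_lt_trans (th t t01) hd).
  have D1 := C1_line oU Cf Uz.
  have D2 : is_derive t (1 : R) (fun s : R => L * s) L.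
    by apply: is_derive_eq; rewrite [_ *: _]mulr1.
  have D3 : is_derive t (1 : R) (fun s : R => 2^-1 * H2 * (s * s)) (H2 * t).
    by apply: is_derive_eq; rewrite /GRing.scale /=; field.
  by apply: is_derive_eq.
  rewrite /g scale1r scale0r addr0 !mulr1 !mulr0 !subr0 => gE.
  rewrite -/L -/H2 [X in `|X|](_ : _ = f (x + h) - L - 2^-1 * H2 - f x); last by ring.
  rewrite gE lin_gradient /L lin_gradient /H2 form_hessian mulr_suml -!sumrB.
  rewrite (le_trans (ler_norm_sum _ _ _))//.
  apply: (@le_trans _ _ (\sum_(i < N) e' * `|h| ^+ 2)); last first.
    rewrite sumr_const card_ord -[leLHS]mulr_natl mulrA ler_wpM2r ?sqr_ge0//.
    by rewrite /e' mulrCA ger_pMr// ler_pdivrMr// mul1r ler_nat.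
  apply: ler_sum => i _.
  have [_ /(_ i)[_]] := Hdel _ (le_lt_trans (th c c01) hd).
  rewrite [x + _ - x]addrAC subrr add0r linZ => Hi.
  rewrite [X in `|X|](_ : _ = h 0 i * (partial i f (x + c *: h) - partial i f x -
    c * lin (gradient (partial i f) x) h)); last by ring.
  rewrite normrM expr2 mulrCA ler_pM ?ler_coord_norm// (le_trans Hi)//.
  by rewrite ler_wpM2l ?(ltW e'0)// th.
Qed.
End taylor.

(** * Hessians and second order conditions on a hypersurface *)

Section hypersurfaces.
Variables (R : realType) (N : nat).
Local Notation E := 'rV[R]_N.
Implicit Types (x y h q X : E) (U M : set E) (f r : E -> R).

Lemma evec_norm_le i : `|evec R i : E| <= 1.
Proof.
apply: ler_norm_coord => // a j; rewrite (ord1 a) evecE.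
by case: eqP; rewrite ?normr1 ?normr0.
Qed.

Lemma lin_gradient_evec f x i : lin (gradient f x) (evec R i) = partial i f x.
Proof. by rewrite lin_evec mxE. Qed.

(** Mean value theorem in direction [i] for the difference in direction [j], then the first order
    expansion of [partial i f] at two points within [2 t] and [t] of [x]. The errors add up to a
    multiple of [3 t], hence [e / 3]. *)
Lemma second_difference U f x i j : open U -> C2_on U f -> U x ->
  forall e : R, 0 < e -> exists2 del : R, 0 < del & forall t : R, 0 < t < del ->
    `|f (x + t *: evec R j + t *: evec R i) - f (x + t *: evec R j)
      - f (x + t *: evec R i) + f x - t ^+ 2 * partial j (partial i f) x|
    <= e * t ^+ 2.
Proof.
move=> oU [Cf Cpf] Ux e e0.
have e30 : 0 < e / 3%:R by rewrite divr_gt0.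
have [del del0 H] := C1_taylor oU (Cpf i) Ux e30.
exists (del / 2) => [|t /andP[t0 td]]; first exact: divr_gt0.
have nt k : `|t *: evec R k : E| <= t.
  by rewrite normrZ gtr0_norm// ler_piMr ?(ltW t0)// evec_norm_le.
have nct c k : 0 <= c <= 1 -> `|c *: (t *: evec R k) : E| <= t.
  move=> /andP[c0 c1]; rewrite normrZ (ger0_norm c0).
  by rewrite (le_trans _ (nt k))// ler_piMl.
have t2 : t + t < del by move: td; rewrite ltr_pdivlMr// mulrDr mulr1.
have t1 : t < del by rewrite (lt_trans _ t2)// ltrDl.
pose g u := f (x + t *: evec R j + u *: (t *: evec R i)) -
  f (x + u *: (t *: evec R i)).
have H1 c : 0 <= c <= 1 -> `|t *: evec R j + c *: (t *: evec R i) : E| <= t + t.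
  by move=> c01; rewrite (le_trans (ler_normD _ _))// lerD// nct.
have [|c c01] := @MVT01 R g (fun u => lin (gradient f (x + t *: evec R j +
    u *: (t *: evec R i))) (t *: evec R i) -
    lin (gradient f (x + u *: (t *: evec R i))) (t *: evec R i)).
  move=> u u01; have [Uz _] := H _ (le_lt_trans (H1 u u01) t2).
  rewrite addrA in Uz; have [Uy _] := H _ (le_lt_trans (nct u i u01) t1).
  have D1 := C1_line oU Cf Uz; have D2 := C1_line oU Cf Uy.
  by apply: is_derive_eq.
rewrite /g !scale1r !scale0r !addr0 !linZ !lin_gradient_evec -mulrBr => gE.
have [_] := H _ (le_lt_trans (H1 c c01) t2).
have [_] := H _ (le_lt_trans (nct c i c01) t1).
rewrite linD addrA (linZ _ t (evec R j)) lin_gradient_evec.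
set a := partial i f (x + _); set b := partial i f (x + _ + _).
set A := partial j _ _; set B := lin _ _ => Ha Hb.
rewrite [X in `|X|](_ : _ = t * ((b - partial i f x - (t * A + B)) -
  (a - partial i f x - B))); last first.
  by rewrite -[LHS]addr0 -[X in _ + X](subrr (t * (b - a))) -[X in _ + (_ - X)]gE; ring.
rewrite normrM gtr0_norm// expr2 mulrCA ler_pM2l// (le_trans (ler_normB _ _))//.
have Hb' := le_trans Hb (ler_wpM2l (ltW e30) (H1 c c01)).
have Ha' := le_trans Ha (ler_wpM2l (ltW e30) (nct c i c01)).
by apply: (le_trans (lerD Hb' Ha')); lra.
Qed.

(** The second difference is symmetric in [i] and [j]; divided by [t ^+ 2], it tends to both mixed
    derivatives. *)
Lemma hessian_sym U f x : open U -> C2_on U f -> U x ->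
  (hessian f x)^T = hessian f x.
Proof.
move=> oU Cf Ux; apply/matrixP => i j; rewrite !mxE.
set a := partial j _ _; set b := partial i _ _.
apply/eqP; rewrite -subr_eq0 -normr_eq0 eq_le normr_ge0 andbT.
apply/ler_addgt0Pl => /= e e0; rewrite addr0.
have e20 : 0 < e / 2 by rewrite divr_gt0.
have [d1 d10 H1] := second_difference i j oU Cf Ux e20.
have [d2 d20 H2] := second_difference j i oU Cf Ux e20.
pose t := Num.min d1 d2 / 2.
have m0 : 0 < Num.min d1 d2 by rewrite lt_min d10.
have t0 : 0 < t by rewrite divr_gt0.
have tm : t < Num.min d1 d2 by rewrite ltr_pdivrMr// ltr_pMr// ltr1n.
move: (tm); rewrite lt_min => /andP[td1 td2].
have := H1 t; rewrite t0 td1 => /(_ isT).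
have := H2 t; rewrite t0 td2 => /(_ isT).
rewrite -/a -/b (addrAC x (t *: evec R i)).
set F1 := f (x + _ + _); set F2 := f (x + _); set F3 := f (x + _) => K2 K1.
clearbody a b t F1 F2 F3.
have t20 : 0 < t ^+ 2 by rewrite exprn_gt0.
rewrite -(ler_pM2r t20) -[t ^+ 2 in leLHS]gtr0_norm// -normrM.
rewrite (_ : _ * _ = (F1 - F2 - F3 + f x - t ^+ 2 * b) -
  (F1 - F3 - F2 + f x - t ^+ 2 * a)); last by ring.
apply: (le_trans (ler_normB _ _)).
rewrite [leRHS](_ : _ = e / 2 * t ^+ 2 + e / 2 * t ^+ 2); first exact: lerD.
by field.
Qed.

(* By the intermediate value theorem in s, since r (q + t X + s t^2 e) is
   t^2 (s + H(X, X) / 2) up to o(t^2). *)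
Lemma local_defining_curve M q r X e : local_defining M q r -> M q ->
  lin (gradient r q) X = 0 -> lin (gradient r q) e = 1 ->
  forall eta : R, 0 < eta -> exists2 tau : R, 0 < tau &
    forall t : R, 0 < `|t| < tau ->
      exists2 s, `|s + 2^-1 * form (hessian r q) X X| <= eta &
                 M (q + (t *: X + (s * t ^+ 2) *: e)).
Proof.
move=> [U [[oU Uq] C2 MU _]] Mq X0 e1 eta eta0.
have rq : r q = 0 by apply/MU.
(* [c0] is the value of [s] that cancels the second order term of [r], and [C] bounds all [s]
   between [c0 - eta] and [c0 + eta]. *)
set H := hessian r q; set c0 := - (2^-1 * form H X X).
pose C := `|c0| + eta.
have C0 : 0 < C by rewrite ltr_wpDl.
pose K := `|X| + C * `|e| + 1.
have K0 : 0 < K by rewrite ltr_wpDl// addr_ge0// mulr_ge0// ltW.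
pose K2 := C * `|form H X e + form H e X| + C ^+ 2 * `|form H e e| + 1.
have K20 : 0 < K2.
  by rewrite ltr_wpDl// addr_ge0// mulr_ge0// ?sqr_ge0// ltW.
(* The Taylor error and the terms of higher order in [t] each cost [eta / 4 * t ^+ 2]. Together they
   stay below [eta * t ^+ 2], the size of the main term at both ends [s = c0 - eta] and
   [s = c0 + eta], so [r] changes sign in between. *)
have ep0 : 0 < eta / (4%:R * K ^+ 2) by rewrite divr_gt0// mulr_gt0// exprn_gt0.
have [del del0 T] := C2_taylor oU C2 Uq ep0.
exists (Num.min 1 (Num.min (del / K) (eta / (2%:R * K2)))) => [|t].
  by rewrite !lt_min ltr01 !divr_gt0//= mulr_gt0.
rewrite !lt_min => /andP[t0 /and3P[t1 td te]].
have nh s : `|s| <= C -> `|t *: X + (s * t ^+ 2) *: e| <= K * `|t|.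
  move=> sC; apply: (le_trans (ler_normD _ _)).
  have -> : `|t *: X| = `|X| * `|t| by rewrite normrZ mulrC.
  have E1 : `|(s * t ^+ 2) *: e| = `|s| * `|e| * `|t| * `|t|.
    by rewrite normrZ normrM normrX; ring.
  have E2 : `|s| * `|e| * `|t| * `|t| <= C * `|e| * `|t| * 1.
    by rewrite ler_pM ?mulr_ge0 ?(ltW t1)// !ler_wpM2r.
  by rewrite /K E1; have := normr_ge0 t; lra.
have hd s : `|s| <= C -> `|t *: X + (s * t ^+ 2) *: e| < del.
  by move=> /nh /le_lt_trans; apply; rewrite mulrC -ltr_pdivlMr.
have key s : `|s| <= C -> `|r (q + (t *: X + (s * t ^+ 2) *: e)) -
    (s - c0) * t ^+ 2| <= eta / 2 * t ^+ 2.
  move=> sC; have [_] := T _ (hd s sC).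
  rewrite rq subr0 linD !linZ X0 e1 mulr0 add0r mulr1 -/H.
  have -> : form H (t *: X + (s * t ^+ 2) *: e) (t *: X + (s * t ^+ 2) *: e) =
      t ^+ 2 * form H X X + t ^+ 2 * t * (s * (form H X e + form H e X) +
      s ^+ 2 * t * form H e e).
    by rewrite !formDl !formDr !formZl !formZr; ring.
  set rr := r _; set Z := s * _ + _ => Hr.
  have HZ : `|Z| <= K2.
    rewrite /Z /K2 ler_wpDr// (le_trans (ler_normD _ _))// lerD//.
      by rewrite normrM ler_wpM2r.
    have -> : `|s ^+ 2 * t * form H e e| = `|s| ^+ 2 * `|t| * `|form H e e|.
      by rewrite expr2 !normrM.
    apply: ler_wpM2r => //; rewrite -[leRHS]mulr1.
    apply: ler_pM; rewrite ?exprn_ge0 ?(ltW t1)//.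
    by rewrite ler_pXn2r// nnegrE ltW.
  rewrite [X in `|X|](_ : _ = (rr - s * t ^+ 2 - 2^-1 * (t ^+ 2 * form H X X +
     t ^+ 2 * t * Z)) + 2^-1 * t ^+ 2 * (t * Z)); last first.
    by rewrite /c0; ring.
  have t2 : 0 <= t ^+ 2 by rewrite sqr_ge0.
  have E1 : `|2^-1 * t ^+ 2 * (t * Z)| <= 2^-1 * t ^+ 2 * (eta / 2).
    have t2h : 0 <= 2^-1 * t ^+ 2 by apply: mulr_ge0.
    rewrite normrM (ger0_norm t2h); apply: ler_wpM2l => //.
    rewrite normrM; apply: le_trans (ler_wpM2l (normr_ge0 t) HZ) _.
    by move/ltW: te; rewrite !ler_pdivlMr ?mulr_gt0// mulrA mulrAC.
  have E2 : eta / (4%:R * K ^+ 2) * `|t *: X + (s * t ^+ 2) *: e| ^+ 2 <=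
      eta / 4%:R * t ^+ 2.
    have -> : eta / 4%:R * t ^+ 2 = eta / (4%:R * K ^+ 2) * (K * `|t|) ^+ 2.
      by rewrite exprMn real_normK ?num_real//; field; rewrite gt_eqF.
    by rewrite ler_wpM2l ?(ltW ep0)// ler_pXn2r ?nnegrE ?mulr_ge0 ?nh// ltW.
  apply: (le_trans (ler_normD _ _)); apply: (le_trans (lerD (le_trans Hr E2) E1)).
  by rewrite le_eqVlt; apply/orP; left; apply/eqP; field.
have t20 : 0 < t ^+ 2 by rewrite -real_normK ?num_real// exprn_gt0.
have Cp : `|c0 + eta| <= C.
  by rewrite (le_trans (ler_normD _ _))// /C (gtr0_norm eta0).
have Cm : `|c0 - eta| <= C.
  by rewrite (le_trans (ler_normB _ _))// /C (gtr0_norm eta0).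
pose g s := r (q + t *: X + s *: (t ^+ 2 *: e)).
have gE s : g s = r (q + (t *: X + (s * t ^+ 2) *: e)).
  by rewrite /g scalerA addrA.
have inC s : c0 - eta <= s <= c0 + eta -> `|s| <= C.
  move=> /andP[s1 s2]; rewrite ler_norml; apply/andP; split.
    by apply: le_trans s1; move: Cm; rewrite ler_norml => /andP[].
  by apply: le_trans s2 _; move: Cp; rewrite ler_norml => /andP[].
have gp : 0 <= g (c0 + eta).
  move: (key _ Cp); rewrite gE; set w := r _.
  rewrite (_ : c0 + eta - c0 = eta); last by ring.
  by rewrite ler_norml => /andP[+ _]; nra.
have gm : g (c0 - eta) <= 0.
  move: (key _ Cm); rewrite gE; set w := r _.
  rewrite (_ : c0 - eta - c0 = - eta); last by ring.
  by rewrite ler_norml => /andP[_ +]; nra.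
have [|||s] := @IVT R g (c0 - eta) (c0 + eta) 0.
- by rewrite lerD2l; lra.
- apply: derivable_within_continuous => s; rewrite in_itv/= => sI.
  have [Us _] := T _ (hd s (inC s sI)).
  have D := @C1_line _ _ U r (q + t *: X) (t ^+ 2 *: e) s oU C2.1.
  by case: D; rewrite // scalerA -addrA.
- by rewrite ge_min gm /= le_max gp orbT.
rewrite in_itv /= => sI gs; exists s.
  rewrite (_ : s + _ = s - c0); last by rewrite /c0 opprK.
  by rewrite ler_norml; case/andP: sI => ? ?; apply/andP; split; lra.
by apply/MU; [have [] := T _ (hd s (inC s sI)) | rewrite -gE].
Qed.

End hypersurfaces.

Section second_order_condition.
Variables (R : realType) (N : nat).
Local Notation E := 'rV[R]_N.
Implicit Types (x y h q X : E) (M : set E) (r : E -> R).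

Lemma lin_normal (l : 'cV[R]_N) : l != 0 -> exists e : E, lin l e = 1.
Proof.
move=> l0; have [i li] : exists i, l i 0 != 0.
  apply/existsP; apply: contraNT l0; rewrite negb_exists => /forallP H.
  by apply/eqP/colP => i; rewrite mxE; apply/eqP; rewrite -[_ == _]negbK.
by exists ((l i 0)^-1 *: evec R i); rewrite linZ lin_evec mulVf.
Qed.

(** Lagrange conditions, read off from [local_defining_curve]. At [h = t X + s t^2 e] the hypothesis
    says [0 <= P X t s]. The order [t] makes [l] vanish on tangent vectors; the order [t ^+ 2],
    where [s] tends to minus half the Hessian form, gives the inequality. *)
Lemma constrained_minimum M q r (l : 'cV[R]_N) (G : 'M[R]_N) :
  local_defining M q r -> M q ->
  (\forall h \near (0 : E), M (q + h) -> 0 <= lin l h + form G h h) ->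
  exists2 lam : R, l = lam *: gradient r q &
    forall X, lin (gradient r q) X = 0 ->
      lam / 2 * form (hessian r q) X X <= form G X X.
Proof.
move=> rM Mq.
move=> /(@nbhs_addP R E)[del del0 Hmin].
have [e e1] : exists e : E, lin (gradient r q) e = 1.
  by have [U [[_ Uq] _ _ g0]] := rM; exact/lin_normal/g0.
pose P X (t s : R) := t * lin l X + s * t ^+ 2 * lin l e + t ^+ 2 * form G X X +
  t ^+ 2 * t * (s * (form G X e + form G e X) + s ^+ 2 * t * form G e e).
have HP X (eta : R) : lin (gradient r q) X = 0 -> 0 < eta ->
    exists2 tau : R, 0 < tau & forall t, 0 < t < tau ->
    exists2 s, `|s + 2^-1 * form (hessian r q) X X| <= eta & 0 <= P X t s.
  move=> X0 eta0; have [tau tau0 H] := local_defining_curve rM Mq X0 e1 eta0.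
  pose C := `|2^-1 * form (hessian r q) X X| + eta.
  have C0 : 0 < C by rewrite ltr_wpDl.
  pose K := `|X| + C * `|e| + 1.
  have K0 : 0 < K by rewrite ltr_wpDl// addr_ge0// mulr_ge0// ltW.
  exists (Num.min tau (Num.min 1 (del / K))) => [|t].
    by rewrite !lt_min tau0 ltr01 divr_gt0.
  rewrite !lt_min => /andP[t0 /and3P[tt t1 td]].
  have [|s sC Ms] := H t; first by rewrite gtr0_norm// t0.
  exists s => //.
  have sC' : `|s| <= C.
    rewrite -[s](addrK (2^-1 * form (hessian r q) X X)).
    by apply: (le_trans (ler_normB _ _)); rewrite addrC lerD2l.
  have hd : `|t *: X + (s * t ^+ 2) *: e| < del.
    apply: (@le_lt_trans _ _ (K * t)); last by rewrite mulrC -ltr_pdivlMr.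
    apply: (le_trans (ler_normD _ _)).
    have -> : `|t *: X| = `|X| * t by rewrite normrZ gtr0_norm// mulrC.
    have E1 : `|(s * t ^+ 2) *: e| = `|s| * `|e| * t * t.
      by rewrite normrZ normrM (gtr0_norm (exprn_gt0 2 t0)); ring.
    have E2 : `|s| * `|e| * t * t <= C * `|e| * t * 1.
      by rewrite ler_pM ?mulr_ge0 ?(ltW t1) ?(ltW t0)// !ler_wpM2r// ltW.
    by rewrite /K E1; lra.
  have := Hmin _ hd; rewrite add0r => /(_ Ms).
  rewrite linD !linZ !formDl !formDr !formZl !formZr.
  by congr (_ <= _); rewrite /P; ring.
have tan_ge X : lin (gradient r q) X = 0 -> 0 <= lin l X.
  move=> X0; apply/ler_addgt0Pl => /= ep ep0.
  have [tau tau0 H] := HP X 1 X0 ltr01.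
  pose C := `|2^-1 * form (hessian r q) X X| + 1.
  have C0 : 0 <= C by rewrite addr_ge0.
  pose B := C * `|lin l e| + `|form G X X| + C * `|form G X e + form G e X| +
    C ^+ 2 * `|form G e e| + 1.
  have B0 : 0 < B by rewrite ltr_wpDl// !addr_ge0// ?mulr_ge0// sqr_ge0.
  pose t := Num.min (tau / 2) (Num.min 1 (ep / B)).
  have t0 : 0 < t by rewrite /t !lt_min ltr01 !divr_gt0.
  have tt : t < tau by rewrite /t gt_min ltr_pdivrMr// ltr_pMr// ltr1n.
  have t1 : t <= 1 by rewrite /t !ge_min lexx !orbT.
  have tB : t * B <= ep by rewrite -ler_pdivlMr// /t !ge_min lexx !orbT.
  clearbody t.
  have [|s sC] := H t; first by rewrite t0.
  have sC' : `|s| <= C.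
    rewrite -[s](addrK (2^-1 * form (hessian r q) X X)).
    by apply: (le_trans (ler_normB _ _)); rewrite addrC lerD2l.
  rewrite /P; set b := form G X e + _; set d := form G e e; set g := form G X X.
  set le := lin l e; set lX := lin l X => HPt.
  have : 0 <= t * (lX + t * (s * le + g + t * (s * b + s ^+ 2 * t * d))).
    by move: HPt; congr (_ <= _); ring.
  rewrite pmulr_rge0// => /le_trans; apply; rewrite addrC lerD2r.
  apply: le_trans tB; rewrite ler_pM2l//.
  have b1 : s * le <= C * `|le|.
    by apply: (le_trans (ler_norm _)); rewrite normrM ler_wpM2r.
  have b2 : g <= `|g| by exact: ler_norm.
  have b3 : t * (s * b) <= C * `|b|.
    apply: (le_trans (ler_norm _)); rewrite !normrM (gtr0_norm t0) -[leRHS]mul1r.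
    by apply: ler_pM => //; [exact: ltW | exact: ler_wpM2r].
  have b4 : t * (s ^+ 2 * t * d) <= C ^+ 2 * `|d|.
    apply: (le_trans (ler_norm _)).
    have -> : `|t * (s ^+ 2 * t * d)| = (t * t) * (`|s| ^+ 2 * `|d|).
      by rewrite expr2 !normrM (gtr0_norm t0); ring.
    rewrite -[leRHS]mul1r.
    have ttle : t * t <= 1 by rewrite mulr_ile1// ltW.
    have ttge : 0 <= t * t by rewrite mulr_ge0// ltW.
    apply: ler_pM => //.
    by rewrite ler_wpM2r// ler_pXn2r// nnegrE.
  by rewrite /B -/b -/d -/g -/le; lra.
(* The tangent space contains [- X] with [X]. *)
have tan0 X : lin (gradient r q) X = 0 -> lin l X = 0.
  move=> X0; apply/eqP; rewrite eq_le tan_ge// andbT -oppr_ge0 -linN.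
  by apply: tan_ge; rewrite linN X0 oppr0.
(* A basis vector minus its value under [gradient r q] times [e] is tangent, so [l] kills it. *)
exists (lin l e) => [|X X0].
  apply/colP => i; rewrite mxE -!lin_evec.
  apply/eqP; rewrite mulrC -subr_eq0 -linZ -linB tan0//.
  by rewrite linB linZ e1 mulr1 subrr.
apply/ler_addgt0Pl => /= ep ep0.
set c0 := 2^-1 * form (hessian r q) X X.
pose eta := Num.min 1 (ep / (2%:R * (`|lin l e| + 1))).
have l1 : 0 < `|lin l e| + 1 by rewrite ltr_wpDl.
have eta0 : 0 < eta by rewrite lt_min ltr01 divr_gt0// mulr_gt0.
have eta1 : eta <= 1 by rewrite ge_min lexx.
have etal : eta * (`|lin l e| + 1) <= ep / 2.
  have E1 : ep / 2 / (`|lin l e| + 1) = ep / (2%:R * (`|lin l e| + 1)).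
    by rewrite invfM mulrA.
  by rewrite -ler_pdivlMr// E1 /eta ge_min lexx orbT.
clearbody eta.
have [tau tau0 H] := HP X eta X0 eta0.
pose C := `|c0| + 1.
have C0 : 0 <= C by rewrite addr_ge0.
pose B := C * `|form G X e + form G e X| + C ^+ 2 * `|form G e e| + 1.
have B0 : 0 < B by rewrite ltr_wpDl// !addr_ge0// ?mulr_ge0// sqr_ge0.
pose t := Num.min (tau / 2) (Num.min 1 (ep / 2 / B)).
have t0 : 0 < t by rewrite /t !lt_min ltr01 !divr_gt0.
have tt : t < tau by rewrite /t gt_min ltr_pdivrMr// ltr_pMr// ltr1n.
have t1 : t <= 1 by rewrite /t !ge_min lexx !orbT.
have tB : t * B <= ep / 2 by rewrite -ler_pdivlMr// /t !ge_min lexx !orbT.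
clearbody t.
have [|s sC] := H t; first by rewrite t0.
have sC' : `|s| <= C.
  rewrite -[s](addrK c0).
  apply: (le_trans (ler_normB _ _)); rewrite addrC lerD2l.
  exact: le_trans eta1.
rewrite /P (tan0 X X0) mulr0 add0r.
rewrite (_ : lin l e / 2 * form (hessian r q) X X = c0 * lin l e); last first.
  by rewrite /c0; field.
move: sC; rewrite -/c0 => sC.
set b := form G X e + _; set d := form G e e; set g := form G X X.
set le := lin l e => HPt.
have : 0 <= t ^+ 2 * (s * le + g + t * (s * b + s ^+ 2 * t * d)).
  by move: HPt; congr (_ <= _); ring.
rewrite pmulr_rge0 ?exprn_gt0// => Hpos.
have b1 : (s + c0) * le <= eta * `|le|.
  by apply: (le_trans (ler_norm _)); rewrite normrM ler_wpM2r.
have b3 : s * b <= C * `|b|.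
  by apply: (le_trans (ler_norm _)); rewrite normrM ler_wpM2r.
have b4 : s ^+ 2 * t * d <= C ^+ 2 * `|d|.
  apply: (le_trans (ler_norm _)).
  have -> : `|s ^+ 2 * t * d| = t * (`|s| ^+ 2 * `|d|).
    by rewrite expr2 !normrM (gtr0_norm t0); ring.
  rewrite -[leRHS]mul1r.
  apply: ler_pM => //; first exact: ltW.
  by rewrite ler_wpM2r// ler_pXn2r// nnegrE.
have b5 : t * (s * b + s ^+ 2 * t * d) <= t * B.
  by rewrite ler_pM2l// /B -/b -/d; lra.
have b6 : eta * `|le| <= ep / 2.
  by apply: le_trans etal; rewrite ler_pM2l// lerDl.
lra.
Qed.

End second_order_condition.

(** * Supporting hyperplanes *)

Section convexity.
Variables (R : realType) (N : nat).
Local Notation E := 'rV[R]_N.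
Implicit Types (x y h q X d : E) (D M W : set E) (r : E -> R).

Lemma convex_setP D : convex_set D <->
  (forall x y (t : R), 0 <= t <= 1 -> D x -> D y -> D ((1 - t) *: x + t *: y)).
Proof.
split=> [cD x y t t01 Dx Dy|H x y l /set_mem Dx /set_mem Dy].
  have /andP[t0 t1] := t01.
  have t1' : 0 <= 1 - t by rewrite subr_ge0.
  have t1'' : 1 - t <= 1 by rewrite gerBl.
  have := cD x y (Itv01 t1' t1'') (mem_set Dx) (mem_set Dy).
  by move/set_mem; rewrite /conv /= /unstable.onem opprB addrCA subrr addr0.
apply: mem_set.
have := H y x l%:inum; rewrite addrC.
by apply => //; apply/andP; split.
Qed.

Lemma convex_closure D : convex_set D -> convex_set (closure D).
Proof.
move=> /convex_setP cD; apply/convex_setP => x y t /andP[t0 t1] Dx Dy.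
move=> A /(@nbhs_addP R E)[del del0 H].
have [x' [Dx' /= xx']] := Dx _ (nbhsx_ballx x del del0).
have [y' [Dy' /= yy']] := Dy _ (nbhsx_ballx y del del0).
exists ((1 - t) *: x' + t *: y'); split; first by apply: cD => //; rewrite t0.
have -> : (1 - t) *: x' + t *: y' = (1 - t) *: x + t *: y +
   ((1 - t) *: (x' - x) + t *: (y' - y)).
  by apply/rowP => i; rewrite !mxE; ring.
apply: H; move: xx' yy'; rewrite -!ball_normE /= => xx' yy'.
apply: (le_lt_trans (ler_normD _ _)); rewrite !normrZ (ger0_norm t0).
rewrite ger0_norm ?subr_ge0// (distrC x') (distrC y').
have [->|tn0] := eqVneq t 0; first by rewrite subr0 mul1r mul0r addr0.
have tp : 0 < t by rewrite lt_neqAle eq_sym tn0.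
have : t * `|y - y'| < t * del by rewrite ltr_pM2l.
have : (1 - t) * `|x - x'| <= (1 - t) * del by rewrite ler_wpM2l ?subr_ge0// ltW.
lra.
Qed.

(** Replacing [q] by a nearby [q'] in [D] is compensated by moving [d] to [d'], which stays in [D]
    because [D] is open. *)
Lemma open_convex_segment D q d (t : R) : open D -> convex_set D ->
  closure D q -> D d -> 0 < t <= 1 -> D (q + t *: (d - q)).
Proof.
move=> oD /convex_setP cD cq Dd /andP[t0 t1].
have /(@nbhs_addP R E)[rho rho0 Hrho] : nbhs d D by exact: open_nbhs_nbhs.
have [q' [Dq' /=]] := cq _ (nbhsx_ballx q _ (mulr_gt0 t0 rho0)).
rewrite -ball_normE /= => qq'.
pose d' := d + ((1 - t) / t) *: (q - q').
have Dd' : D d'.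
  apply: Hrho; rewrite normrZ normrM normfV (gtr0_norm t0) mulrAC ltr_pdivrMr//.
  rewrite [rho * _]mulrC ger0_norm ?subr_ge0//; apply: le_lt_trans qq'.
  by rewrite ler_piMl// gerBl ltW.
rewrite (_ : q + _ = (1 - t) *: q' + t *: d'); first by apply: cD => //; rewrite t1 ltW.
by apply/rowP => i; rewrite !mxE; field; rewrite gt_eqF.
Qed.

(** [nu] is the gradient of [r] at [q] up to sign. If it vanished on [d - q] for some [d] in [D],
    points of [M] on a curve tangent to [d - q] would lie in [D], although [M] is in the boundary.
    Being nonzero on the convex set [D], it has constant sign there. *)
Lemma supporting_hyperplane D W M q r : D !=set0 -> open D -> convex_set D ->
  open W -> M = W `&` boundary D -> M q -> local_defining M q r ->
  exists2 nu : 'cV[R]_N, nu != 0 & forall d, D d -> 0 < lin nu (d - q).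
Proof.
move=> [d0 Dd0] oD cD oW ME Mq rM.
have cq : closure D q by move: Mq; rewrite ME => -[_ []].
have [U [[_ Uq] _ _ g0']] := rM; have g0 := g0' q Uq Mq.
have [e e1] := lin_normal g0.
have nz d : D d -> lin (gradient r q) (d - q) != 0.
  move=> Dd; apply/eqP => X0.
  have /(@nbhs_addP R E)[rho rho0 Hrho] : nbhs d D by exact: open_nbhs_nbhs.
  have [tau tau0 H] := local_defining_curve rM Mq X0 e1 ltr01.
  set c := 2^-1 * _ in H.
  pose C := (`|c| + 1) * `|e| + 1.
  have C0 : 0 < C by rewrite ltr_wpDl// mulr_ge0// addr_ge0.
  pose t := Num.min (tau / 2) (Num.min 1 (rho / 2 / C)).
  have t0 : 0 < t by rewrite /t !lt_min ltr01 !divr_gt0.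
  have tt : t < tau by rewrite /t gt_min ltr_pdivrMr// ltr_pMr// ltr1n.
  have t1 : t <= 1 by rewrite /t !ge_min lexx !orbT.
  have tC : t * C <= rho / 2 by rewrite -ler_pdivlMr// /t !ge_min lexx !orbT.
  clearbody t.
  have [|s sC Ms] := H t; first by rewrite gtr0_norm// t0.
  have sC' : `|s| <= `|c| + 1.
    rewrite -[s](addrK c).
    by apply: (le_trans (ler_normB _ _)); rewrite addrC lerD2l.
  (* The correction [s * t ^+ 2] of the curve is absorbed by displacing the end point [d] by
     [s * t], little enough to stay in [D]. *)
  have Dk : D (d + (s * t) *: e).
    apply: Hrho; rewrite normrZ normrM (gtr0_norm t0).
    have : `|s| * `|e| <= (`|c| + 1) * `|e| by rewrite ler_wpM2r.
    by move: tC; rewrite /C; nra.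
  have t01 : 0 < t <= 1 by rewrite t0.
  have := open_convex_segment oD cD cq Dk t01.
  have -> : q + t *: (d + (s * t) *: e - q) = q + (t *: (d - q) + (s * t ^+ 2) *: e).
    by apply/rowP => i; rewrite !mxE; ring.
  move=> DM; move: Ms; rewrite ME => -[_ [_]]; apply.
  by move: oD; rewrite openE; apply.
have same a b : D a -> D b -> 0 < lin (gradient r q) (a - q) ->
    0 < lin (gradient r q) (b - q).
  move=> Da Db a0; have := nz b Db; rewrite neq_lt => /orP[b0|//].
  set A := lin _ _ in a0; set B := lin _ _ in b0.
  (* The zero of the affine function on the segment from [a] to [b]. *)
  pose t := A / (A - B).
  have AB : 0 < A - B by rewrite subr_gt0 (lt_trans b0).
  have t01 : 0 <= t <= 1.
    rewrite divr_ge0 ?(ltW a0) ?(ltW AB)//= ler_pdivrMr// mul1r lerBrDr gerDl.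
    exact: ltW.
  have /convex_setP/(_ a b t t01 Da Db) := cD.
  move=> /nz; rewrite (_ : (1 - t) *: a + t *: b - q = (1 - t) *: (a - q) + t *: (b - q)).
    rewrite [lin _ (_ *: _ + _)]linD !linZ -/A -/B (_ : _ + _ = 0) ?eqxx// /t; field.
    by rewrite gt_eqF.
  by apply/rowP => i; rewrite !mxE; ring.
have := nz d0 Dd0; rewrite neq_lt => /orP[dn|dp].
  exists (- gradient r q); rewrite ?oppr_eq0// => d Dd; rewrite linlN oppr_gt0.
  have := nz d Dd; rewrite neq_lt => /orP[//|dp].
  by have := same d d0 Dd Dd0 dp; rewrite ltNge (ltW dn).
by exists (gradient r q) => // d Dd; exact: same dp.
Qed.

Lemma lin_closure D (nu : 'cV[R]_N) q : (forall d, D d -> 0 < lin nu (d - q)) ->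
  forall x, closure D x -> 0 <= lin nu (x - q).
Proof.
move=> H x cx; rewrite leNgt; apply/negP => x0.
have lc : continuous (fun y => lin nu (y - q)).
  move=> y; rewrite (_ : (fun y => _) = fun y => lin nu y - lin nu q); last first.
    by apply/funext => z; rewrite linB.
  apply: (@continuousB R R E (lin nu) (fun=> lin nu q) y).
    exact: lin_continuous.
  exact: continuous_cstR.
have nx : nbhs x [set y | lin nu (y - q) < 0] by exact: cvgr_lt (lc x) _ x0.
have [d [Dd /= dx]] := cx _ nx.
by have := H d Dd; rewrite ltNge (ltW dx).
Qed.

(** The supporting form [nu] is minimal at [q] on [M], so the second order condition applies with
    [G = 0]. The sign of [lam] depends on the side on which [r] is positive. *)
Lemma tangent_form_semidefinite M q r : convex_hypersurface M -> M q ->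
  local_defining M q r -> exists2 lam : R, lam != 0 &
    forall X, lin (gradient r q) X = 0 -> 0 <= lam * form (hessian r q) X X.
Proof.
move=> [D [D0 oD cD [W oW ME]]] Mq rM.
have [nu nu0 Hnu] := supporting_hyperplane D0 oD cD oW ME Mq rM.
have [|lam nuE H] := @constrained_minimum R N M q r nu 0 rM Mq.
  near=> h => Mh; rewrite /form mulmx0 mul0mx mxE addr0.
  have -> : h = (q + h) - q by rewrite addrAC subrr add0r.
  by apply: (lin_closure Hnu); move: Mh; rewrite ME => -[_ []].
exists (- lam).
  by rewrite oppr_eq0; apply: contra nu0 => /eqP l0; rewrite nuE l0 scale0r.
move=> X X0; have := H X X0; rewrite {2}/form mulmx0 mul0mx mxE => HX.
rewrite mulNr oppr_ge0; move: HX; rewrite mulrAC pmulr_lle0//.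
Unshelve. all: by end_near. Qed.

End convexity.

(** * Separation *)

Section separation.
Variables (R : realType) (N : nat).
Local Notation E := 'rV[R]_N.
Implicit Types (K S : set E) (g : E -> R).

Definition weights n (w : 'I_n -> R) := (forall i, 0 <= w i) /\ \sum_i w i = 1.

Lemma affinely_dependent d (p : 'I_d.+2 -> 'rV[R]_d) :
  exists mu : 'I_d.+2 -> R, [/\ exists i, 0 < mu i, \sum_i mu i = 0 &
    \sum_i mu i *: p i = 0].
Proof.
(* The points preceded by a coordinate 1: [d + 2] rows of length [d + 1] are linearly dependent. *)
pose A : 'M[R]_(d.+2, d.+1) :=
  \matrix_(i, j) if unlift ord0 j is Some k then p i 0 k else 1.
have : kermx A != 0.
  rewrite kermx_eq0 /row_free neq_ltn; apply/orP; left.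
  by rewrite ltnS (leq_trans (rank_leq_col A)).
move=> /rowV0Pn[v /sub_kermxP vA v0].
have vE j : \sum_i v 0 i * (if unlift ord0 j is Some k then p i 0 k else 1) = 0.
  have /(congr1 (fun B : 'rV[R]_d.+1 => B 0 j)) := vA.
  by rewrite !mxE; apply: etrans; apply: eq_bigr => i _; rewrite mxE.
have S1 : \sum_i v 0 i = 0.
  by have := vE ord0; rewrite unlift_none; under eq_bigr do rewrite mulr1.
have S2 : \sum_i v 0 i *: p i = 0.
  apply/rowP => k; rewrite summxE mxE; have := vE (lift ord0 k); rewrite liftK.
  by apply: etrans; apply: eq_bigr => i _; rewrite mxE.
have [i vi] : exists i, v 0 i != 0.
  apply/existsP; apply: contraNT v0; rewrite negb_exists => /forallP H.
  by apply/eqP/rowP => i; rewrite mxE; apply/eqP; rewrite -[_ == _]negbK.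
have [[j vj]|Hno] := pselect (exists j, 0 < v 0 j); first by exists (v 0); split=> //; exists j.
exists (fun j => - v 0 j); split.
- exists i; rewrite oppr_gt0 lt_neqAle vi leNgt; apply/negP => vip.
  by apply: Hno; exists i.
- by rewrite sumrN S1 oppr0.
- by under eq_bigr do rewrite scaleNr; rewrite sumrN S2 oppr0.
Qed.

(** Subtract from [w] the largest multiple of an affine dependence [mu] that keeps the weights
    nonnegative. The factor is the least [w i / mu i] with [mu i > 0], and the weight attaining it
    becomes 0. *)
Lemma caratheodory_step d (p : 'I_d.+2 -> 'rV[R]_d) (w : 'I_d.+2 -> R) :
  weights w -> exists2 w', weights w' & exists2 i, w' i = 0 &
    \sum_i w' i *: p i = \sum_i w i *: p i.
Proof.
move=> [w0 w1]; have [mu [[i0 mui0] mu0 mup]] := affinely_dependent p.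
pose th i := w i / mu i.
have [i mui imin] : exists2 i, 0 < mu i & forall j, 0 < mu j -> th i <= th j.
  case: (@Order.TotalTheory.arg_minP _ R _ i0 (fun i => 0 < mu i) th mui0).
  by move=> i mui imin; exists i.
exists (fun j => w j - th i * mu j).
  split=> [j|]; last by rewrite sumrB w1 -mulr_sumr mu0 mulr0 subr0.
  have th0 : 0 <= th i by rewrite divr_ge0// ltW.
  have [muj|muj] := ltP 0 (mu j).
    by rewrite subr_ge0 -ler_pdivlMr//; exact: imin.
  by rewrite subr_ge0 (le_trans _ (w0 j))// mulr_ge0_le0.
exists i; first by rewrite /th divfK ?subrr// gt_eqF.
under eq_bigr do rewrite scalerBl -scalerA.
by rewrite sumrB -scaler_sumr mup scaler0 subr0.
Qed.

(** The missing weight is carried by the point 0. *)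
Lemma convex_sum K n (w : 'I_n -> R) (p : 'I_n -> E) : convex_set K -> K 0 ->
  (forall i, 0 <= w i) -> \sum_i w i <= 1 -> (forall i, K (p i)) ->
  K (\sum_i w i *: p i).
Proof.
move=> /convex_setP cK K0; elim: n w p => [|n IH] w p w0 w1 Kp.
  by rewrite big_ord0.
rewrite big_ord_recl; move: w1; rewrite big_ord_recl => w1.
have s0 : 0 <= \sum_(i < n) w (lift ord0 i) by rewrite sumr_ge0.
have le1 : w ord0 <= 1 by lra.
have [e1|n1] := eqVneq (w ord0) 1.
  have z : \sum_(i < n) w (lift ord0 i) = 0 by lra.
  rewrite [X in _ + X]big1 ?addr0 ?e1 ?scale1r// => i _.
  have /eqP := z; rewrite psumr_eq0// => /allP/(_ i).
  by rewrite mem_index_enum => /(_ isT)/eqP->; rewrite scale0r.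
have lt1 : 0 < 1 - w ord0 by rewrite subr_gt0 lt_neqAle n1.
rewrite addrC.
rewrite (_ : \sum_(i < n) _ = (1 - w ord0) *:
    \sum_(i < n) (w (lift ord0 i) / (1 - w ord0)) *: p (lift ord0 i)).
  apply: cK => //; first by rewrite w0.
  apply: IH => [i||//]; first by rewrite divr_ge0// ltW.
  by rewrite -mulr_suml ler_pdivrMr// mul1r; lra.
rewrite scaler_sumr; apply: eq_bigr => i _.
by rewrite scalerA mulrCA divff ?mulr1// gt_eqF.
Qed.

Lemma rV_coord_continuous (T : topologicalType) n (i : 'I_n) :
  continuous (fun v : 'rV[T]_n => v 0 i).
Proof.
move=> v A vA; exists (fun _ j => if j == i then A else setT).
  by move=> a j; rewrite (ord1 a); case: eqP => [->//|_]; exact: filterT.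
by move=> M /(_ 0 i); rewrite eqxx.
Qed.


Lemma continuous_minR (T : topologicalType) (f : T -> R) :
  continuous f -> continuous (fun t => Num.min (f t) 0).
Proof.
move=> cf t; apply: (@continuous_min R T f (fun=> 0) t); first exact: cf.
exact: cvg_cst.
Qed.

(* The squared distance from (x, u) to the ray {0} x [0, +oo[. *)
Definition ray_dist (x : E) (u : R) := \sum_j x 0 j ^+ 2 + Num.min u 0 ^+ 2.

Definition combine n (w : 'I_n -> R) (p : 'I_n -> E) := \sum_i w i *: p i.
Definition combineR n (w : 'I_n -> R) (p : 'I_n -> E) g := \sum_i w i * g (p i).

(* N + 2 points suffice by Caratheodory's theorem in dimension N + 1; fixing their
   number makes the set of competitors compact. *)
Lemma nearest_combination S g : S !=set0 -> compact S -> continuous g ->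
  exists w : 'I_N.+2 -> R, exists p : 'I_N.+2 -> E,
  [/\ weights w, forall i, S (p i) &
    forall (w' : 'I_N.+2 -> R) p', weights w' -> (forall i, S (p' i)) ->
      ray_dist (combine w p) (combineR w p g) <=
      ray_dist (combine w' p') (combineR w' p' g)].
Proof.
move=> [s0 Ss0] cS cg.
pose f (v : ('rV[R]_N.+2 * 'rV[E]_N.+2)%type) := ray_dist (combine (fun i => v.1 0 i) (fun i => v.2 0 i))
  (combineR (fun i => v.1 0 i) (fun i => v.2 0 i) g).
pose A := [set l : 'rV[R]_N.+2 | forall i, `[0, 1]%classic (l 0 i)] `*`
  [set P : 'rV[E]_N.+2 | forall i, S (P 0 i)].
pose B := [set v : ('rV[R]_N.+2 * 'rV[E]_N.+2)%type | \sum_i v.1 0 i = 1].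
have c1 i : continuous (fun v : ('rV[R]_N.+2 * 'rV[E]_N.+2)%type => v.1 0 i).
  move=> v; apply: (@continuous_comp _ _ _ fst (fun l : 'rV[R]_N.+2 => l 0 i)).
    exact: cvg_fst.
  exact: rV_coord_continuous.
have c2 i : continuous (fun v : ('rV[R]_N.+2 * 'rV[E]_N.+2)%type => v.2 0 i).
  move=> v; apply: (@continuous_comp _ _ _ snd (fun P : 'rV[E]_N.+2 => P 0 i)).
    exact: cvg_snd.
  exact: rV_coord_continuous.
have cA : compact A.
  apply: compact_setX; last by apply: (@rV_compact E N.+2 (fun=> S)).
  by apply: (@rV_compact R N.+2 (fun=> `[0, 1]%classic)) => _; exact: segment_compact.
have clB : closed B.
  apply: (@preimage_closed _ _ (fun v : ('rV[R]_N.+2 * 'rV[E]_N.+2)%type => \sum_i v.1 0 i) [set 1]).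
    by move=> v _; exact: (continuous_sumR c1).
  exact: closed_eq.
have cAB : compact (A `&` B) by exact: compact_closedI.
have cf : continuous f.
  pose T := ('rV[R]_N.+2 * 'rV[E]_N.+2)%type.
  pose F1 (v : T) := \sum_j (combine (fun i => v.1 0 i) (fun i => v.2 0 i)) 0 j ^+ 2.
  pose F2 (v : T) := Num.min (combineR (fun i => v.1 0 i) (fun i => v.2 0 i) g) 0 ^+ 2.
  suff [cF1 cF2] : continuous F1 /\ continuous F2.
    by move=> v; exact: (@continuousD R R _ F1 F2 v (cF1 v) (cF2 v)).
  split.
    apply: continuous_sumR => j.
    under eq_fun do rewrite expr2 summxE.
    apply: continuous_mulR; apply: continuous_sumR => i;
      under eq_fun do rewrite mxE; apply: continuous_mulR => // v;
      by apply: (@continuous_comp _ _ _ (fun v : ('rV[R]_N.+2 * 'rV[E]_N.+2)%type => v.2 0 i)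
        (fun x : E => x 0 j)); [exact: c2|exact: continuous_coord].
  rewrite /F2; under eq_fun do rewrite expr2.
  have cR : continuous (fun v : ('rV[R]_N.+2 * 'rV[E]_N.+2)%type =>
      combineR (fun i => v.1 0 i) (fun i => v.2 0 i) g).
    apply: continuous_sumR => i; apply: continuous_mulR => // v.
    by apply: (@continuous_comp _ _ _ (fun v : ('rV[R]_N.+2 * 'rV[E]_N.+2)%type => v.2 0 i) g);
      [exact: c2|exact: cg].
  by apply: continuous_mulR; exact: continuous_minR.
have mkAB (w : 'I_N.+2 -> R) (p : 'I_N.+2 -> E) : weights w -> (forall i, S (p i)) ->
    (A `&` B) (\row_i w i, \row_i p i).
  move=> [w0 w1] Sp; split; first split=> i; rewrite /= ?mxE//.
    rewrite in_itv /= w0 /= -w1 (bigD1 i) //= lerDl.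
    by rewrite sumr_ge0.
  by rewrite /B /= -[RHS]w1; apply: eq_bigr => i _; rewrite mxE.
have neAB : A `&` B !=set0.
  exists (\row_i (i == ord0)%:R, \row_i s0); apply: mkAB => //; split=> [i|].
    by case: eqP.
  by rewrite (bigD1 ord0) //= big1 ?addr0// => i /negPf->.
have [v /set_mem[[Av Sv] Bv] Hv] := compact_EVT_min neAB cAB (continuous_subspaceT cf).
exists (fun i => v.1 0 i), (fun i => v.2 0 i); split=> //.
- by split=> [i|//]; have := Av i; rewrite /= in_itv /= => /andP[].
- move=> w' p' ww' Sp'; have := Hv _ (mem_set (mkAB w' p' ww' Sp')).
  rewrite /f; congr (_ <= _); congr ray_dist; apply: eq_bigr => i _;
  by rewrite !mxE.
Qed.

(* Otherwise the convex hull of the graph of g on S meets the ray {0} x [0, +oo[: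
   some convex combination of points w_i of S is 0 while that of the g w_i is
   nonnegative; but then - t *: w_i is in K for some t > 0. *)
Lemma tilt_negative K S g : convex_set K -> K 0 -> S `<=` K ->
  compact S -> continuous g ->
  (forall w, S w -> (exists2 t : R, 0 < t & K (- t *: w)) -> g w < 0) ->
  exists a : 'cV[R]_N, forall w, S w -> lin a w + g w < 0.
Proof.
move=> cK K0 SK cS cg Hg.
have [->|/set0P Sn0] := eqVneq S set0; first by exists 0.
have [w [p [[w0 w1] Sp Hmin]]] := nearest_combination Sn0 cS cg.
set W := combine w p in Hmin; set u := combineR w p g in Hmin.
(* [(W, tau)] is the vector from the nearest point of the ray to [(W, u)], [e] is its squared
   length, and [eE'] is its scalar product with [(W, u)]. *)
pose tau := Num.min u 0.
pose e := ray_dist W u.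
have eE : e = \sum_j W 0 j ^+ 2 + tau ^+ 2 by [].
have linW s : lin W^T s = \sum_j W 0 j * s 0 j.
  by rewrite linE; apply: eq_bigr => j _; rewrite mxE mulrC.
have eE' : e = lin W^T W + tau * u.
  have -> : tau * u = tau ^+ 2.
    by rewrite /tau; case: ltP => _; rewrite expr2// !mul0r.
  by rewrite eE linW; under [in RHS]eq_bigr do rewrite -expr2.
have e_ge0 : 0 <= e by rewrite eE addr_ge0 ?sqr_ge0// sumr_ge0// => j _; exact: sqr_ge0.
have e0 : e != 0.
  apply/eqP => e0; move: e0; rewrite eE => /eqP.
  rewrite paddr_eq0 ?sqr_ge0//; last by rewrite sumr_ge0// => j _; exact: sqr_ge0.
  rewrite sqrf_eq0 => /andP[W0 tau0].
  have W0' : W = 0.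
    apply/rowP => j; rewrite mxE; apply/eqP; rewrite -sqrf_eq0.
    move: W0; rewrite psumr_eq0 => [/allP/(_ j)|i _]; last exact: sqr_ge0.
    by rewrite mem_index_enum => /(_ isT).
  have u0 : 0 <= u by move: tau0; rewrite /tau; case: ltP => // ult /eqP u0; rewrite u0 ltxx in ult.
  have gneg i : 0 < w i -> g (p i) < 0.
    move=> wi; apply: Hg => //; exists (w i) => //.
    (* The [i]-th point is replaced by 0 but keeps its weight, so the weights still sum to 1. *)
    have -> : - w i *: p i = \sum_j w j *: (if j == i then 0 else p j).
      move/eqP: W0'; rewrite /W /combine (bigD1 i) //= addrC addr_eq0 => /eqP HW.
      rewrite (bigD1 i) //= eqxx scaler0 add0r scaleNr -HW.
      by apply: eq_bigr => j /negPf->.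
    apply: convex_sum => // [|j]; first by rewrite w1.
    by case: eqP => // _; exact: SK.
  have [i wi] : exists i, 0 < w i.
    apply: contrapT => Hno; have := w1; rewrite big1 => [/eqP|j _].
      by rewrite eq_sym oner_eq0.
    apply/eqP; rewrite eq_le w0 andbT leNgt; apply/negP => wj.
    by apply: Hno; exists j.
  move: u0; rewrite /u /combineR (bigD1 i) //= => u0.
  have : w i * g (p i) < 0 by rewrite pmulr_rlt0// gneg.
  have : \sum_(j < N.+2 | j != i) w j * g (p j) <= 0.
    apply: sumr_le0 => j _; have [wj|wj] := ltP 0 (w j).
      by rewrite ltW// pmulr_rlt0// gneg.
    have -> : w j = 0 by apply/eqP; rewrite eq_le wj w0.
    by rewrite mul0r.
  lra.
have ep : 0 < e by rewrite lt_neqAle eq_sym e0.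
(* Variational inequality for a nearest point, from comparison with the combinations that give a
   small weight [t] to [s]. *)
have key s : S s -> e <= lin W^T s + tau * g s.
  move=> Ss.
  pose dl := lin W^T (s - W) + tau * (g s - u).
  suff : 0 <= dl by rewrite /dl linB eE'; lra.
  pose C := \sum_j (s - W) 0 j ^+ 2 + (g s - u) ^+ 2.
  have C0 : 0 <= C by rewrite addr_ge0 ?sqr_ge0// sumr_ge0// => j _; exact: sqr_ge0.
  have H t : 0 < t <= 1 -> 0 <= dl * 2 + t * C.
    move=> /andP[t0 t1].
    pose q (i : 'I_N.+3) := if unlift ord0 i is Some k then p k else s.
    pose v (i : 'I_N.+3) := if unlift ord0 i is Some k then (1 - t) * w k else t.
    have vw : weights v.
      split=> [i|].
        rewrite /v; case: unlift => [k|]; last exact: ltW.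
        by rewrite mulr_ge0// subr_ge0.
      rewrite big_ord_recl /v unlift_none; under eq_bigr do rewrite liftK.
      by rewrite -mulr_sumr w1; ring.
    (* Adding [s] makes [N + 3] points. One Caratheodory step for the points [(g (q i), q i)] in
       dimension [N + 1] leaves [N + 2] of them and changes neither combination, so [Hmin]
       applies. *)
    pose q1 (i : 'I_N.+3) : 'rV[R]_N.+1 := \row_j
      (if unlift ord0 j is Some k then q i 0 k else g (q i)).
    have [v' v'w [i v'i q1E]] := caratheodory_step q1 vw.
    have qE : \sum_i v' i *: q i = \sum_i v i *: q i.
      apply/rowP => k; move: q1E => /rowP/(_ (lift ord0 k)); rewrite !summxE.
      under eq_bigr do rewrite !mxE liftK.
      under [in X in _ = X -> _]eq_bigr do rewrite !mxE liftK.
      by move=> H; under eq_bigr do rewrite mxE; under [RHS]eq_bigr do rewrite mxE.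
    have gE : \sum_i v' i * g (q i) = \sum_i v i * g (q i).
      move: q1E => /rowP/(_ ord0); rewrite !summxE.
      under eq_bigr do rewrite !mxE unlift_none.
      by under [in X in _ = X -> _]eq_bigr do rewrite !mxE unlift_none.
    have drop (V : lmodType R) (h : 'I_N.+3 -> V) :
        \sum_j v' (lift i j) *: h (lift i j) = \sum_j v' j *: h j.
      by rewrite [RHS](bigD1_ord i) //= v'i scale0r add0r.
    have ww' : weights (fun j => v' (lift i j)).
      split=> [j|]; first by have [] := v'w.
      have [_ <-] := v'w; have := drop R^o (fun=> 1).
      by under eq_bigr do rewrite [_ *: _]mulr1; under [RHS]eq_bigr do rewrite [_ *: _]mulr1.
    have Sq j : S (q (lift i j)) by rewrite /q; case: unlift.
    have := Hmin _ _ ww' Sq; rewrite -/e.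
    have -> : combine (fun j => v' (lift i j)) (fun j => q (lift i j)) = W + t *: (s - W).
      rewrite /combine (drop E q) qE big_ord_recl /v /q unlift_none.
      under eq_bigr do rewrite liftK -scalerA.
      by rewrite -scaler_sumr -/(combine w p) -/W; apply/rowP => j; rewrite !mxE; ring.
    have -> : combineR (fun j => v' (lift i j)) (fun j => q (lift i j)) g = u + t * (g s - u).
      rewrite /combineR (drop R^o (g \o q)) gE big_ord_recl /v /q unlift_none.
      under eq_bigr do rewrite liftK -mulrA.
      by rewrite -mulr_sumr -/(combineR w p g) -/u; ring.
    move=> le1.
    (* The distance to the ray is at most the distance to its fixed point [u - tau]. *)
    have le2 : Num.min (u + t * (g s - u)) 0 ^+ 2 <= (tau + t * (g s - u)) ^+ 2.
      rewrite /tau; set z := t * (g s - u).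
      have [hu|hu] := ltP u 0; have [hv|hv] := ltP (u + z) 0;
        rewrite ?expr0n /= ?sqr_ge0// add0r.
      by nra.
    have : e <= \sum_j (W + t *: (s - W)) 0 j ^+ 2 + (tau + t * (g s - u)) ^+ 2.
      by apply: (le_trans le1); rewrite /ray_dist lerD2l.
    have -> : \sum_j (W + t *: (s - W)) 0 j ^+ 2 =
        \sum_j W 0 j ^+ 2 + t * 2 * lin W^T (s - W) + t ^+ 2 * \sum_j (s - W) 0 j ^+ 2.
      rewrite linW !mulr_sumr -!big_split /=; apply: eq_bigr => j _.
      by rewrite !mxE; ring.
    rewrite eE => le3.
    have : 0 <= t * (dl * 2 + t * C).
      by rewrite /dl /C; move: le3; set a1 := \sum_j _; set a2 := lin _ _; set a3 := \sum_j _; lra.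
    by rewrite pmulr_rge0.
  rewrite leNgt; apply/negP => dn.
  pose t := Num.min 1 (- dl / (C + 1)).
  have C1 : 0 < C + 1 by rewrite ltr_wpDl.
  have t0 : 0 < t by rewrite /t lt_min ltr01 divr_gt0// oppr_gt0.
  have t1 : t <= 1 by rewrite /t ge_min lexx.
  have tC : t * (C + 1) <= - dl by rewrite -ler_pdivlMr// /t ge_min lexx orbT.
  have := H t; rewrite t0 t1 => /(_ isT); clearbody t; nra.
(* If [tau < 0], dividing [key] by [tau] gives the form. If [tau = 0], then [lin W^T] is at least
   [e > 0] on [S], and a large negative multiple of it beats the maximum of [g]. *)
have [taun|tau_ge] := ltP tau 0.
  exists (tau^-1 *: W^T) => s Ss; rewrite linlZ.
  have -> : tau^-1 * lin W^T s + g s = tau^-1 * (lin W^T s + tau * g s).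
    by rewrite mulrDr mulrA mulVf ?mul1r// lt_eqF.
  by rewrite nmulr_rlt0 ?invr_lt0// (lt_le_trans ep)// key.
have tau0 : tau = 0 by apply/eqP; rewrite eq_le tau_ge /tau ge_min lexx orbT.
have [s0 _ Hs0] := compact_EVT_max Sn0 cS (continuous_subspaceT cg).
exists (- ((`|g s0| + 1) / e) *: W^T) => s Ss; rewrite linlZ.
have := key s Ss; rewrite tau0 mul0r addr0 => ks.
have gs : g s <= `|g s0| by rewrite (le_trans (Hs0 s (mem_set Ss)))// ler_norm.
have : (`|g s0| + 1) / e * e <= (`|g s0| + 1) / e * lin W^T s.
  by rewrite ler_wpM2l// divr_ge0 ?ltW// ltr_wpDl.
rewrite divfK ?gt_eqF// mulNr; lra.
Qed.

End separation.

(** * Touching from inside *)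

Section touching.
Variables (R : realType) (N : nat).
Local Notation E := 'rV[R]_N.
Implicit Types (x h q X : E) (D M W O : set E) (r : E -> R).

Lemma formlZ (c : R) (G : 'M[R]_N) x h : form (c *: G) x h = c * form G x h.
Proof. by rewrite /form -scalemxAr -scalemxAl [LHS]mxE. Qed.

Lemma form1E h : form 1%:M h h = \sum_i h 0 i ^+ 2.
Proof.
by rewrite /form mulmx1 mxE; apply: eq_bigr => i _; rewrite mxE.
Qed.

Lemma form1_ge0 h : 0 <= form 1%:M h h.
Proof. by rewrite form1E sumr_ge0// => i _; exact: sqr_ge0. Qed.

Lemma form1_eq0 h : form 1%:M h h = 0 -> h = 0.
Proof.
rewrite form1E => /eqP; rewrite psumr_eq0 => [/allP H|i _]; last exact: sqr_ge0.
apply/rowP => i; rewrite mxE; apply/eqP; rewrite -sqrf_eq0.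
by have := H i; rewrite mem_index_enum => /(_ isT).
Qed.

(** On the left the sup norm, on the right the squared Euclidean norm. *)
Lemma norm_le_form1 h : `|h| ^+ 2 <= form 1%:M h h.
Proof.
have [->|h0] := eqVneq h 0; first by rewrite normr0 expr0n /= form1_ge0.
have [[a i] /= hi] : exists i, `|h| = `|h i.1 i.2|.
  by apply: mx_norm_neq0; apply: contra h0 => /eqP/mx_norm_eq0 ->.
rewrite hi (ord1 a) real_normK ?num_real// form1E (bigD1 i)//= lerDl.
by rewrite sumr_ge0// => j _; exact: sqr_ge0.
Qed.

Lemma continuous_norm : continuous (fun h : E => `|h|).
Proof. exact: norm_continuous. Qed.

Lemma compact_closure_ball D q (rho : R) :
  compact [set h | closure D (q + h) /\ `|h| <= rho].
Proof.
apply: bounded_closed_compact.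
  exists rho; split; first exact: num_real.
  by move=> M' rM h [_ hr]; exact: le_trans hr (ltW rM).
apply: closedI.
  apply: (@preimage_closed _ _ (fun h : E => q + h) (closure D)).
    move=> h _; apply: (@continuousD R E E (fun=> q) id h); first exact: (@cst_continuous E E q h).
    exact: cvg_id.
  exact: closed_closure.
apply: (@preimage_closed _ _ (fun h : E => `|h|) [set y | y <= rho]).
  by move=> h _; exact: continuous_norm.
exact: closed_le.
Qed.

(** The part shared by the real and the complex case. [G] is the form Q of the overview: it
    dominates the identity on two-sided directions and is free elsewhere. Ranks enter only when the
    second order condition at [x] is exploited. *)
Lemma touching_point D W M q (nu : 'cV[R]_N) (G : 'M[R]_N) O :
  open D -> convex_set D -> open W -> M = W `&` boundary D ->
  C2_hypersurface M -> M q -> nu != 0 ->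
  (forall d, D d -> 0 < lin nu (d - q)) ->
  (forall v (t : R), 0 < t -> closure D (q + v) -> closure D (q - t *: v) ->
     form 1%:M v v <= form G v v) ->
  nbhs q O ->
  exists x r, [/\ M x, O x, local_defining M x r & exists lam : R,
    forall X, lin (gradient r x) X = 0 ->
      - form G X X <= lam * form (hessian r x) X X].
Proof.
move=> oD cD oW ME C2M Mq nu0 Hnu HG nO.
have cq : closure D q by move: Mq; rewrite ME => -[_ []].
have Wq : W q by move: Mq; rewrite ME => -[].
have lnu := lin_closure Hnu.
have lnu' h : closure D (q + h) -> 0 <= lin nu h.
  by move=> /lnu; rewrite addrAC subrr add0r.
have [rho rho0 Hrho] : exists2 rho : R, 0 < rho &
    forall h, `|h| <= rho -> O (q + h) /\ W (q + h).
  have nW : nbhs q W by exact: open_nbhs_nbhs.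
  have [del del0 H] := (@nbhs_addP R E q _).1 (filterI nO nW).
  exists (del / 2) => [|h hd]; first exact: divr_gt0.
  by apply: H; apply: (le_lt_trans hd); rewrite ltr_pdivrMr// ltr_pMr// ltr1n.
pose A := [set h | closure D (q + h) /\ `|h| <= rho].
have cA : compact A := @compact_closure_ball D q rho.
have norm_cl (c : R) : closed [set h : E | `|h| = c].
  apply: (@preimage_closed _ _ (fun h : E => `|h|) [set c]).
    by move=> h _; exact: continuous_norm.
  exact: closed_eq.
have nu_cl (c : R) : closed [set h : E | lin nu h = c].
  apply: (@preimage_closed _ _ (lin nu) [set c]).
    by move=> h _; exact: lin_continuous.
  exact: closed_eq.
pose K := [set h | closure D (q + h) /\ lin nu h = 0].
pose S := [set h | A h /\ (`|h| = rho /\ lin nu h = 0)].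
have cS : compact S.
  by apply: compact_closedI => //; exact: closedI (norm_cl rho) (nu_cl 0).
have cK : convex_set K.
  apply/convex_setP => h k t t01 [Dh h0] [Dk k0]; split.
    have -> : q + ((1 - t) *: h + t *: k) = (1 - t) *: (q + h) + t *: (q + k).
      by apply/rowP => i; rewrite !mxE; ring.
    by move/convex_setP: (convex_closure cD); apply.
  by rewrite linD !linZ h0 k0 !mulr0 addr0.
have K0 : K 0 by split; rewrite ?addr0 ?lin0.
have SK : S `<=` K by move=> h [[Dh _] [_ h0]].
(* Any value strictly between 0 and [rho ^+ 2] would do: [phi] is positive at [q], and [dl] is below
   [form G h h] for two-sided [h] of norm [rho]. *)
pose dl := rho ^+ 2 / 2.
have dl0 : 0 < dl by rewrite divr_gt0// exprn_gt0.
have cg : continuous (fun h : E => dl - form G h h).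
  move=> h; apply: (@continuousB R R E (fun=> dl) (fun h => form G h h) h).
    exact: continuous_cstR.
  exact: form_continuous.
have [||||||a Ha] := @tilt_negative R N K S (fun h => dl - form G h h) => //.
  move=> h [[Dh hr] [hrho h0]] [t t0 [Dt _]].
  have := HG h t t0 Dh; rewrite -scaleNr => /(_ Dt) H.
  have := norm_le_form1 h; rewrite hrho => H2.
  rewrite subr_lt0; apply: lt_le_trans H; apply: lt_le_trans H2.
  by rewrite /dl ltr_pdivrMr// ltr_pMr ?exprn_gt0// ltr1n.
pose phi h := lin a h + (dl - form G h h).
have cphi : continuous phi.
  move=> h; apply: (@continuousD R R E (lin a) (fun h => dl - form G h h) h).
    exact: lin_continuous.
  exact: cg.
have [e e1] := lin_normal nu0.
have [cG cG0 HcG] := form_bound G.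
(* Bounds the rate of change of [phi] along [- e] at points of [A]; [nu] decreases at rate 1 in this
   direction. *)
pose Bd := `|lin a e| + 2%:R * (cG * (rho * `|e|)) + `|form G e e| + 1.
have Bd0 : 0 < Bd.
  by rewrite ltr_wpDl// !addr_ge0// mulr_ge0// mulr_ge0 ?(ltW cG0)// mulr_ge0// ltW.
(* On the rest of the sphere [phi] is negative and [nu] nonnegative, which is enough. By the choice
   of [a] the compact set [T] misses the hyperplane [nu = 0], so [nu] has a positive minimum on [T]
   unless [T] is empty. *)
pose T := [set h | A h /\ (`|h| = rho /\ 0 <= phi h)].
have [eps1 eps10 Heps1] : exists2 eps1 : R, 0 < eps1 &
    forall eps, 0 < eps <= eps1 -> forall h, A h -> `|h| = rho ->
      0 < lin nu h - eps * phi h.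
  have cT : compact T.
    have phi_cl : closed [set h | 0 <= phi h].
      apply: (@preimage_closed _ _ phi [set y : R | 0 <= y]).
        by move=> z _; exact: cphi.
      exact: closed_ge.
    by apply: compact_closedI => //; exact: closedI (norm_cl rho) phi_cl.
  have neg eps h : 0 < eps -> A h -> `|h| = rho -> ~ T h -> 0 < lin nu h - eps * phi h.
    move=> eps0 Ah hr nT; have ph : phi h < 0.
      by rewrite ltNge; apply/negP => ph; apply: nT.
    have := lnu' h Ah.1; have : 0 < eps * - phi h by rewrite mulr_gt0// oppr_gt0.
    lra.
  have [T0|/set0P T0] := eqVneq T set0.
    exists 1 => // eps /andP[eps0 _] h Ah hr; apply: neg => //.
    by rewrite T0.
  have [h1 /set_mem Th1 min1] := compact_EVT_min T0 cT
    (continuous_subspaceT (@lin_continuous R N nu)).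
  have [h2 _ max2] := compact_EVT_max T0 cT (continuous_subspaceT cphi).
  have c0 : 0 < lin nu h1.
    have [Ah1 [hr ph]] := Th1; rewrite lt_neqAle lnu' ?andbT//; last exact: Ah1.1.
    rewrite eq_sym; apply/eqP => h10.
    have Sh1 : S h1 by [].
    by have := Ha h1 Sh1; rewrite ltNge ph.
  have F0 : 0 < `|phi h2| + 1 by rewrite ltr_wpDl.
  exists (lin nu h1 / (2%:R * (`|phi h2| + 1))) => [|eps /andP[eps0 epsle] h Ah hr].
    by rewrite divr_gt0// mulr_gt0.
  have [Th|nTh] := pselect (T h); last exact: neg.
  have m1 := min1 h (mem_set Th); have m2 := max2 h (mem_set Th).
  have m3 : phi h <= `|phi h2| + 1.
    by rewrite (le_trans m2)// (le_trans (ler_norm _))// lerDl.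
  move: epsle; rewrite ler_pdivlMr ?mulr_gt0// => epsle.
  have : eps * phi h <= eps * (`|phi h2| + 1) by rewrite ler_pM2l.
  lra.
pose eps := Num.min eps1 (1 / (2%:R * Bd)).
have eps0 : 0 < eps by rewrite lt_min eps10 divr_gt0// mulr_gt0.
have epsB : eps * Bd <= 2^-1.
  have E1 : (1 / (2%:R * Bd)) * Bd = 2^-1 by field; rewrite gt_eqF.
  by rewrite -E1 ler_pM2r// /eps ge_min lexx orbT.
have Heps := Heps1 eps; rewrite eps0 /eps ge_min lexx -/eps in Heps.
have {}Heps := Heps isT.
clearbody eps.
pose psi h := lin nu h - eps * phi h.
have cpsi : continuous psi.
  move=> h; apply: (@continuousB R R E (lin nu) (fun h => eps * phi h) h).
    exact: lin_continuous.
  by apply: continuous_mulR => //; exact: continuous_cstR.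
have A0 : A 0 by split; rewrite ?addr0// normr0 ltW.
have [|h1 /set_mem Ah1 min1] := compact_EVT_min _ cA (continuous_subspaceT cpsi).
  by exists 0.
have psi0 : psi h1 < 0.
  apply: le_lt_trans (min1 0 (mem_set A0)) _.
  by rewrite /psi /phi !lin0 form0l subr0 !add0r oppr_lt0 mulr_gt0.
have hlt : `|h1| < rho.
  rewrite lt_neqAle Ah1.2 andbT; apply/eqP => hr.
  by have := Heps h1 Ah1 hr; rewrite ltNge (ltW psi0).
have psiD h k : psi (h + k) = psi h + (lin nu k - eps * lin a k +
    eps * (form G h k + form G k h)) + eps * form G k k.
  by rewrite /psi /phi !linD !formDl !formDr; ring.
(* Otherwise a small step along [- e] stays in [A] and lowers [psi]. *)
have nDx : ~ D (q + h1).
  move=> Dx; have nD : nbhs (q + h1) D by exact: open_nbhs_nbhs.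
  have [del del0 Hdel] := (@nbhs_addP R E (q + h1) _).1 nD.
  pose s := Num.min 1 (Num.min del (rho - `|h1|) / (2%:R * (`|e| + 1))).
  have ep0 : 0 < `|e| + 1 by rewrite ltr_wpDl.
  have m0 : 0 < Num.min del (rho - `|h1|) by rewrite lt_min del0 subr_gt0.
  have s0 : 0 < s by rewrite /s lt_min ltr01 divr_gt0// mulr_gt0.
  have s1 : s <= 1 by rewrite /s ge_min lexx.
  have se : `|(- s) *: e| < Num.min del (rho - `|h1|).
    rewrite normrZ normrN (gtr0_norm s0).
    have : s * (2%:R * (`|e| + 1)) <= Num.min del (rho - `|h1|).
      by rewrite -ler_pdivlMr ?mulr_gt0// /s ge_min lexx orbT.
    by have := normr_ge0 e; have := mulr_ge0 (ltW s0) (normr_ge0 e); nra.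
  move: se; rewrite lt_min => /andP[sd sr]; clearbody s.
  have As : A (h1 + (- s) *: e).
    split; first by apply: subset_closure; rewrite addrA; exact: Hdel.
    by rewrite (le_trans (ler_normD _ _))// -lerBrDl ltW.
  have := min1 _ (mem_set As); rewrite psiD !linZ !formZr !formZl e1.
  set la := lin a e; set b1 := form G h1 e; set b2 := form G e h1.
  set d := form G e e => Hm.
  have b1le : `|b1| <= cG * (rho * `|e|).
    by apply: (le_trans (HcG _ _)); rewrite ler_pM2l// ler_wpM2r// ltW.
  have b2le : `|b2| <= cG * (rho * `|e|).
    by apply: (le_trans (HcG _ _)); rewrite mulrC [leRHS]mulrC ler_pM2r// mulrC ler_wpM2r// ltW.
  have sd' : s * d <= `|d|.
    apply: (le_trans (ler_norm _)); rewrite normrM gtr0_norm// ler_piMl//.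
  have up : la - (b1 + b2) + s * d <= Bd.
    move: b1le b2le; rewrite !ler_norml => /andP[? ?] /andP[? ?].
    have := ler_norm la; rewrite /Bd -/la -/d; lra.
  have : eps * (la - (b1 + b2) + s * d) <= 2^-1.
    by apply: le_trans epsB; rewrite ler_pM2l.
  have : 0 <= s * (eps * (la - (b1 + b2) + s * d) - 1) by lra.
  by rewrite pmulr_rge0//; lra.
have [Ox Wx] := Hrho h1 Ah1.2.
have Mx : M (q + h1).
  rewrite ME; split=> //; split; first exact: Ah1.1.
  by move=> /interior_subset.
have [r rM] := C2M _ Mx.
exists (q + h1), r; split=> //.
(* [psi (h1 + k) - psi h1] is this linear form plus [eps *: G]; the terms containing [h1] are the
   derivative of the quadratic part at [h1]. *)
have [|lam _ Hlam] := @constrained_minimum R N M (q + h1) r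
    (nu - eps *: a + eps *: (G^T *m h1^T + G *m h1^T)) (eps *: G) rM Mx.
  apply/(@nbhs_addP R E); exists (rho - `|h1|); first by rewrite subr_gt0.
  move=> k kr; rewrite add0r => Mk.
  have Ak : A (h1 + k).
    split; first by rewrite addrA; move: Mk; rewrite ME => -[_ []].
    by rewrite (le_trans (ler_normD _ _))// addrC -lerBrDr ltW.
  have := min1 _ (mem_set Ak); rewrite psiD -addrA lerDl.
  have linlD (l l' : 'cV[R]_N) x : lin (l + l') x = lin l x + lin l' x.
    by rewrite /lin mulmxDr mxE.
  have L1 : lin (G *m h1^T) k = form G k h1 by rewrite /lin mulmxA.
  have L2 : lin (G^T *m h1^T) k = form G h1 k.
    have E1 : k *m (G^T *m h1^T) = (h1 *m G *m k^T)^T by rewrite !trmx_mul trmxK.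
    by rewrite /lin E1 mxE.
  rewrite !linlD linlN !linlZ linlD L1 L2.
  by rewrite formlZ.
exists (- (lam / 2) / eps) => X X0; have := Hlam X X0.
rewrite formlZ.
rewrite -ler_pdivrMl// => H; rewrite !mulNr lerN2.
by move: H; rewrite mulrA [eps^-1 * _]mulrC.
Qed.

End touching.

(** * Linear algebra and semidefinite forms *)

Section linear_algebra.
Variables (F : fieldType) (N : nat).

(** Writing [A = D *m T], the rows of [D] are in the left kernel of [T *m C]. Applied with [T] a
    basis of the tangent space and [A] the direction of a plane on which the form degenerates. *)
Lemma mxrank_null_rows m1 m (A : 'M[F]_(m1, N)) (T : 'M[F]_(m, N)) (C : 'M[F]_(N, m)) :
  (A <= T)%MS -> A *m C = 0 -> (\rank (T *m C) <= m - \rank A)%N.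
Proof.
move=> /submxP[D ->] DC; rewrite leq_subRL; last first.
  by rewrite (leq_trans (mxrankM_maxl _ _))// rank_leq_col.
rewrite addnC; apply: leq_trans (_ : \rank D + \rank (T *m C) <= m)%N.
  by rewrite addnC leq_add2r mxrankM_maxl.
by apply: mulmx0_rank_max; rewrite mulmxA.
Qed.

(** A form of rank at most [k] on the span of [T] has a kernel of dimension at least [m - k], which
    is too large to miss [L]. In the uses [C] is the form times the (conjugate) transpose of [T], so
    [z *m C = 0] says that [z] is orthogonal to all of [T]. *)
Lemma null_vector_in_subspace m (T : 'M[F]_(m, N)) (C : 'M[F]_(N, m)) (L : 'M[F]_N) k :
  row_free T -> (\rank (T *m C) <= k)%N -> (N + k < m + \rank L)%N ->
  exists z : 'rV[F]_N, [/\ z != 0, (z <= L)%MS, (z <= T)%MS & z *m C = 0].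
Proof.
move=> fT rk dimL; pose K := kermx (T *m C) *m T.
have rK : (m - k <= \rank K)%N.
  by rewrite mxrankMfree// mxrank_ker leq_sub2l.
have : (K :&: L)%MS != 0.
  rewrite -mxrank_eq0 -lt0n.
  have := mxrank_sum_cap K L; have := rank_leq_col (K + L)%MS.
  move: rK dimL; rewrite leq_subLR; lia.
move=> /rowV0Pn[z /[!sub_capmx] /andP[zK zL] z0]; exists z; split => //.
  by rewrite (submx_trans zK)// submxMl.
have /submxP[D ->] := zK.
by rewrite /K mulmxA -(mulmxA _ T C) -mulmxA mulmx_ker mulmx0.
Qed.

(** Take a matrix of maximal rank with row space in [V]: a vector of [V] outside the row space would
    raise the rank. *)
Lemma subspace_mx (V : set 'rV[F]_N) : V 0 ->
  (forall a u v, V u -> V v -> V (a *: u + v)) ->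
  exists B : 'M[F]_N, forall v, V v <-> (v <= B)%MS.
Proof.
move=> V0 Vl.
pose P d := `[< exists B : 'M[F]_N, \rank B = d /\ forall v, (v <= B)%MS -> V v >].
have exP : exists d, P d.
  exists 0%N; apply/asboolP; exists 0; split; first exact: mxrank0.
  by move=> v; rewrite submx0 => /eqP->.
have bP d : P d -> (d <= N)%N.
  by move=> /asboolP[B [<- _]]; exact: rank_leq_col.
case: (ex_maxnP exP bP) => d /asboolP[B [rB BV]] maxd.
exists B => v; split=> [Vv|]; last exact: BV.
apply: contrapT => /negP nvB.
have : P (\rank (B + v)%MS).
  apply/asboolP; exists (B + v)%MS; split => // x /sub_addsmxP[[u1 u2] ->] /=.
  have -> : u2 *m v = u2 0 0 *: v.
    by rewrite [u2]mx11_scalar mul_scalar_mx mxE eqxx mulr1n.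
  by rewrite addrC; apply: Vl => //; apply: BV; rewrite submxMl.
move=> /maxd; rewrite -rB leqNgt => /negP; apply.
have sB : (B <= B + v)%MS by exact: addsmxSl.
rewrite ltnNge; apply: contra nvB => le.
have : \rank B == \rank (B + v)%MS by rewrite eqn_leq le mxrankS.
by rewrite (mxrank_leqif_sup sB) => /(submx_trans (addsmxSr B v)).
Qed.

Lemma subspace_of_rank (B : 'M[F]_N) d : (d <= \rank B)%N ->
  exists B' : 'M[F]_(d, N), row_free B' /\ (B' <= B)%MS.
Proof.
move=> dB; exists (pid_mx d *m row_base B); split.
  by rewrite /row_free mxrankMfree ?row_base_free// rank_pid_mx.
by rewrite (submx_trans (submxMl _ _))// eq_row_base.
Qed.

Lemma vspace_of_mx m (B : 'M[F]_(m, N)) : row_free B ->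
  exists A : {vspace 'rV[F]_N}, \dim A = m /\ forall v, v \in A <-> (v <= B)%MS.
Proof.
move=> fB; pose f : 'Hom('rV[F]_m, 'rV[F]_N) := linfun (mulmxr B).
exists (limg f); split.
  have kf : (fullv :&: lker f = 0)%VS.
    apply/eqP; rewrite -subv0; apply/subvP => u.
    rewrite memv_cap memv_ker memv0 => /andP[_]; rewrite lfunE /= => /eqP uB.
    apply/eqP; move/row_freeP: fB => [B' BB'].
    by rewrite -[u]mulmx1 -BB' mulmxA uB mul0mx.
  by rewrite limg_dim_eq// dimvf /dim /= mul1n.
move=> v; split=> [/memv_imgP[u _ ->]|/submxP[u ->]].
  by rewrite lfunE /= submxMl.
by apply/memv_imgP; exists u; rewrite ?memvf// lfunE.
Qed.

Lemma mx_of_vspace (A : {vspace 'rV[F]_N}) :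
  exists B : 'M[F]_(\dim A, N), \rank B = \dim A /\ forall v, (v <= B)%MS -> v \in A.
Proof.
pose B := \matrix_(i < \dim A) (vbasis A)`_i.
have BE (u : 'rV_(\dim A)) : u *m B = \sum_i u 0 i *: (vbasis A)`_i.
  by rewrite mulmx_sum_row; apply: eq_bigr => i _; rewrite rowK.
exists B; split; last first.
  move=> v /submxP[u ->]; rewrite BE memv_suml// => i _.
  by rewrite memvZ// vbasis_mem// mem_nth// size_tuple.
apply/eqP; rewrite -[_ == _]/(row_free B) -kermx_eq0.
apply/rowV0P => u /sub_kermxP; rewrite BE => uB.
have /freeP/(_ (fun i => u 0 i) uB) H := basis_free (vbasisP A).
by apply/rowP => i; rewrite H mxE.
Qed.

Lemma affine_plane_direction d (P : set 'rV[F]_N) q : affine_plane d P -> P q ->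
  exists B : 'M[F]_(d, N), \rank B = d /\ forall v, (v <= B)%MS -> P (q + v).
Proof.
move=> [a [A [dA PE]]] Pq; have [B [rB BA]] := mx_of_vspace A.
move: B rB BA; rewrite dA => B rB BA; exists B; split=> // v /BA vA.
by move: Pq; rewrite PE /= => Pq; rewrite addrAC memvD.
Qed.

Lemma affine_plane_through d (B : 'M[F]_(d, N)) q : row_free B ->
  affine_plane d [set x | (x - q <= B)%MS].
Proof.
move=> fB; have [A [dA AB]] := vspace_of_mx fB.
exists q, A; split=> //; apply/seteqP; split=> x /=; by move/AB.
Qed.

End linear_algebra.

Section quadratic_forms.
Variables (R : realType) (N : nat).
Local Notation E := 'rV[R]_N.
Implicit Types (v X : E) (H P : 'M[R]_N).

Lemma form_gram m (C : 'M[R]_(N, m)) v : form (C *m C^T) v v = form 1%:M (v *m C) (v *m C).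
Proof. by rewrite /form mulmx1 trmx_mul !mulmxA. Qed.

(** Since [v] is isotropic, the form is affine in [t] along [X + t v]; being of constant sign it has
    slope 0. *)
Lemma semidefinite_null H (T : set E) (lam : R) v : H^T = H -> lam != 0 ->
  (forall X, T X -> 0 <= lam * form H X X) ->
  (forall X (t : R), T X -> T (X + t *: v)) -> form H v v = 0 ->
  forall X, T X -> form H v X = 0.
Proof.
move=> sH lam0 Hpos Tv vv X TX.
set b := form H v X; set a := lam * form H X X.
apply/eqP/negPn/negP => b0.
have lb : lam * b != 0 by rewrite mulf_neq0.
(* With this [t] the form times [lam] equals -1. *)
have /Hpos := Tv X (- (a + 1) / (2%:R * (lam * b))) TX.
rewrite formDl !formDr !formZl !formZr vv (form_sym X v sH) -/b !mulr0 addr0.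
rewrite (_ : lam * _ = a + - (a + 1) / (2 * (lam * b)) * (2 * (lam * b))); last first.
  by rewrite /a; ring.
by rewrite divfK ?mulf_neq0 ?pnatr_eq0//; lra.
Qed.

(** Compare the maximum of one form with the minimum of the other on the compact unit sphere of the
    cone [L]. *)
Lemma dominate_norm (L : set E) P : closed L ->
  (forall v (t : R), L v -> L (t *: v)) -> (forall v, L v -> v != 0 -> 0 < form P v v) ->
  exists c : R, forall v, L v -> v != 0 -> form 1%:M v v < c * form P v v.
Proof.
move=> cL Lt LP; pose S := [set v | L v /\ `|v| = 1].
have cS : compact S.
  apply: bounded_closed_compact.
    exists 1; split; first exact: num_real.
    by move=> M' rM h [_ /= ->]; exact: ltW.
  apply: closedI => //.
  apply: (@preimage_closed _ _ (fun h : E => `|h|) [set y : R | y = 1]).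
    by move=> h _; exact: continuous_norm.
  exact: closed_eq.
have nz v : L v -> v != 0 -> S (`|v|^-1 *: v).
  move=> Lv v0; split; first exact: Lt.
  by rewrite normrZ normfV normr_id mulVf// normr_eq0.
have [S0|/set0P S0] := eqVneq S set0.
  by exists 1 => v Lv v0; have := nz v Lv v0; rewrite S0.
have [v1 /set_mem[Lv1 v11] min1] := compact_EVT_min S0 cS
  (continuous_subspaceT (@form_continuous R N P)).
have [v2 _ max2] := compact_EVT_max S0 cS
  (continuous_subspaceT (@form_continuous R N 1%:M)).
have m0 : 0 < form P v1 v1 by rewrite LP// -normr_eq0 v11 oner_eq0.
exists ((form 1%:M v2 v2 + 1) / form P v1 v1) => v Lv v0.
have Sv := mem_set (nz v Lv v0).
have n0 : 0 < `|v| by rewrite normr_gt0.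
have vE Q : form Q v v = `|v| ^+ 2 * form Q (`|v|^-1 *: v) (`|v|^-1 *: v).
  by rewrite formZl formZr; field; rewrite gt_eqF.
rewrite (vE P) (vE 1%:M) mulrCA ltr_pM2l ?exprn_gt0//.
apply: le_lt_trans (max2 _ Sv) _.
apply: (@lt_le_trans _ _ (form 1%:M v2 v2 + 1)); first by rewrite ltrDl.
rewrite mulrAC ler_pdivlMr// ler_pM2l ?min1//.
by rewrite ltr_wpDl// form1_ge0.
Qed.

Lemma submx_closed (L : 'M[R]_N) : closed [set v : E | (v <= L)%MS].
Proof.
pose C := cokermx L.
rewrite (_ : [set _ | _] = (fun v : E => form (C *m C^T) v v) @^-1` [set y | y = 0]).
  apply: preimage_closed; last exact: closed_eq.
  by move=> v _; exact: form_continuous.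
apply/seteqP; split=> v /=; rewrite form_gram submxE.
  by move=> /eqP->; rewrite form0l.
by move=> H; apply/eqP; exact: form1_eq0.
Qed.

(** [r] vanishes along the line, so the coefficients of its Taylor expansion in [t] vanish one after
    the other. *)
Lemma flat_direction M (q : E) r v : local_defining M q r -> M q ->
  (\forall t \near (0 : R), M (q + t *: v)) ->
  lin (gradient r q) v = 0 /\ form (hessian r q) v v = 0.
Proof.
move=> [U [[oU Uq] C2 MU _]] Mq /(@nbhs_addP R R)[d1 d10 HM].
have rq : r q = 0 by apply/MU.
set L := lin _ _; set F := form _ _ _.
have K e : 0 < e -> exists2 tau : R, 0 < tau & forall t, 0 < t < tau ->
    `|L + t * (2^-1 * F)| <= e * t.
  move=> e0; have v0 : 0 < `|v| ^+ 2 + 1 by rewrite ltr_wpDl// exprn_ge0.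
  have [d2 d20 T] := C2_taylor oU C2 Uq (divr_gt0 e0 v0).
  exists (Num.min d1 (d2 / (`|v| + 1))) => [|t].
    by rewrite lt_min d10 divr_gt0// ltr_wpDl.
  rewrite lt_min => /andP[t0 /andP[td1 td2]].
  have hd : `|t *: v| < d2.
    rewrite normrZ gtr0_norm//; move: td2; rewrite ltr_pdivlMr ?ltr_wpDl//.
    by apply: le_lt_trans; rewrite ler_pM2l// lerDl.
  have [Uz] := T _ hd.
  have -> : r (q + t *: v) = 0.
    by apply/MU => //; have := HM t; rewrite add0r; apply; rewrite gtr0_norm.
  rewrite rq linZ formZl formZr -/L -/F normrZ gtr0_norm//.
  rewrite (_ : 0 - 0 - t * L - 2^-1 * (t * (t * F)) = - (t * (L + t * (2^-1 * F)))); last by ring.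
  rewrite normrN normrM gtr0_norm// => H.
  have : t * `|L + t * (2^-1 * F)| <= t * (e * t).
    apply: le_trans H _; rewrite mulrAC ler_pdivrMr// exprMn.
    have : 0 <= e * t ^+ 2 by rewrite mulr_ge0 ?(ltW e0) ?sqr_ge0.
    by lra.
  by rewrite ler_pM2l.
have L0 : L = 0.
  apply/eqP; rewrite -normr_eq0 eq_le normr_ge0 andbT.
  apply/ler_addgt0Pl => /= e e0; rewrite addr0.
  have [tau tau0 H] := K 1 ltr01.
  have F0 : 0 < `|2^-1 * F| + 1 by rewrite ltr_wpDl.
  pose t := Num.min (tau / 2) (e / (`|2^-1 * F| + 1)).
  have t0 : 0 < t by rewrite lt_min !divr_gt0.
  have tt : t < tau by rewrite gt_min ltr_pdivrMr// ltr_pMr// ltr1n.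
  have te : t * (`|2^-1 * F| + 1) <= e by rewrite -ler_pdivlMr// ge_min lexx orbT.
  have := H t; rewrite t0 tt => /(_ isT) Ht; clearbody t.
  rewrite -[L](addrK (t * (2^-1 * F))); apply: (le_trans (ler_normB _ _)).
  rewrite [X in _ + X]normrM (gtr0_norm t0); lra.
split=> //; apply/eqP; rewrite -normr_eq0 eq_le normr_ge0 andbT.
apply/ler_addgt0Pl => /= e e0; rewrite addr0.
have e20 : 0 < e / 2 by rewrite divr_gt0.
have [tau tau0 H] := K _ e20.
have := H (tau / 2); rewrite divr_gt0// ltr_pdivrMr// ltr_pMr// ltr1n => /(_ isT).
rewrite L0 add0r normrM gtr0_norm ?divr_gt0// mulrC ler_pM2r ?divr_gt0//.
by rewrite normrM gtr0_norm; lra.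
Qed.

End quadratic_forms.

(** * The real case *)

Section lineality.
Variables (R : realType) (N : nat).
Local Notation E := 'rV[R]_N.
Implicit Types (u v x q X : E) (D M W O : set E) (r : E -> R).

Definition lineality D q : set E :=
  [set v | exists2 t : R, 0 < t & forall s, `|s| <= t -> closure D (q + s *: v)].

Lemma lineality0 D q : closure D q -> lineality D q 0.
Proof. by move=> cq; exists 1 => // s _; rewrite scaler0 addr0. Qed.

Lemma linealityDZ D q (a : R) u v : convex_set D ->
  lineality D q u -> lineality D q v -> lineality D q (a *: u + v).
Proof.
move=> cD [tu tu0 Hu] [tv tv0 Hv].
have a1 : 0 < 2%:R * (`|a| + 1) by rewrite mulr_gt0// ltr_wpDl.
(* [q + s *: (a *: u + v)] is the midpoint of two points at parameter [2 s] along [a *: u] and [v],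
   hence the factors 2. *)
exists (Num.min (tv / 2) (tu / (2%:R * (`|a| + 1)))) => [|s].
  by rewrite lt_min !divr_gt0.
rewrite le_min ler_pdivlMr// ler_pdivlMr// => /andP[s1 s2].
have h01 : 0 <= (2^-1 : R) <= 1 by apply/andP; split; lra.
have Du : closure D (q + (2%:R * s * a) *: u).
  apply: Hu; rewrite !normrM (ger0_norm (ler0n _ _)).
  by have := normr_ge0 s; have := mulr_ge0 (normr_ge0 s) (normr_ge0 a); lra.
have Dv : closure D (q + (2%:R * s) *: v).
  by apply: Hv; rewrite normrM (ger0_norm (ler0n _ _)); lra.
have -> : q + s *: (a *: u + v) =
   (1 - 2^-1) *: (q + (2%:R * s * a) *: u) + 2^-1 *: (q + (2%:R * s) *: v).
  by apply/rowP => i; rewrite !mxE; field.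
by move/convex_setP: (convex_closure cD); apply.
Qed.

Lemma lineality_segment D q v (t : R) : convex_set D -> closure D q -> 0 < t ->
  closure D (q + v) -> closure D (q - t *: v) -> lineality D q v.
Proof.
move=> /convex_closure/convex_setP cD cq t0 Dp Dm.
exists (Num.min 1 t) => [|s]; first by rewrite lt_min ltr01.
rewrite le_min => /andP[s1 st].
have [s0|s0] := leP 0 s.
  have -> : q + s *: v = (1 - s) *: q + s *: (q + v).
    by apply/rowP => i; rewrite !mxE; ring.
  by apply: cD => //; rewrite s0 -(ger0_norm s0).
have -> : q + s *: v = (1 - (- s / t)) *: q + (- s / t) *: (q - t *: v).
  by apply/rowP => i; rewrite !mxE; field; rewrite gt_eqF.
apply: cD => //; move: st; rewrite ltr0_norm// => st.
by rewrite divr_ge0 ?oppr_ge0 ?(ltW s0) ?(ltW t0)//= ler_pdivrMr// mul1r.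
Qed.

Lemma lineality_tangent D q (nu : 'cV[R]_N) v :
  (forall d, D d -> 0 < lin nu (d - q)) -> lineality D q v -> lin nu v = 0.
Proof.
move=> /lin_closure lnu [t t0 H].
have := lnu _ (H t _); rewrite gtr0_norm// lexx => /(_ isT).
have := lnu _ (H (- t) _); rewrite normrN gtr0_norm// lexx => /(_ isT).
have E (w : E) : q + w - q = w by rewrite addrAC subrr add0r.
rewrite !E !linZ mulNr oppr_ge0 => h1 h2.
have /eqP : t * lin nu v = 0 by apply/eqP; rewrite eq_le; apply/andP; split; lra.
by rewrite mulf_eq0 gt_eqF//= => /eqP.
Qed.

(** The segments have no common length a priori. Those along the finitely many vectors of a basis
    span a cross-polytope inside the closure, and it contains a ball of the row space. *)
Lemma lineality_ball D q (B : 'M[R]_N) : convex_set D -> closure D q ->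
  (forall v, (v <= B)%MS -> lineality D q v) ->
  exists2 del : R, 0 < del &
    forall v, (v <= B)%MS -> `|v| < del -> closure D (q + v).
Proof.
move=> cD cq BV; pose b := row_base B.
have /choice[t Ht] : forall i : 'I_(\rank B), exists t : R, 0 < t /\
    forall s, `|s| <= t -> closure D (q + s *: row i b).
  move=> i; have [|t t0 H] := BV (row i b); last by exists t.
  by rewrite (submx_trans (row_sub _ _))// eq_row_base.
have /choice[c Hc] : forall i : 'I_(\rank B), exists c : R, 0 < c /\
    forall v, `|(v *m pinvmx b) 0 i| <= c * `|v|.
  move=> i; have [c c0 H] := lin_bound (col i (pinvmx b)).
  exists c; split=> // v; apply: le_trans (H v).
  rewrite [leLHS](_ : _ = `|lin (col i (pinvmx b)) v|)// /lin !mxE.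
  by congr `| _ |; apply: eq_bigr => j _; rewrite [in RHS]mxE.
pose C := \sum_i c i / t i + 1.
have C0 : 0 < C.
  rewrite ltr_wpDl// sumr_ge0// => i _.
  by have [? _] := Hc i; have [? _] := Ht i; rewrite divr_ge0// ltW.
exists C^-1 => [|v vB vd]; first by rewrite invr_gt0.
pose u i := (v *m pinvmx b) 0 i.
(* [v] as a combination of vertices of the cross-polytope; the weights sum to at most [C * |v|],
   which is below 1. *)
have vE : v = \sum_i (`|u i| / t i) *: ((Num.sg (u i) * t i) *: row i b).
  have vb : (v <= b)%MS by rewrite eq_row_base.
  rewrite -[LHS](mulmxKpV vb) mulmx_sum_row; apply: eq_bigr => i _.
  have [ti _] := Ht i; rewrite scalerA; congr (_ *: _).
  by rewrite -/(u i) {1}[u i]numEsg; field; rewrite gt_eqF.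
pose K := [set h | closure D (q + h)].
have cK : convex_set K.
  apply/convex_setP => h k s s01 Dh Dk; rewrite /K /=.
  have -> : q + ((1 - s) *: h + s *: k) = (1 - s) *: (q + h) + s *: (q + k).
    by apply/rowP => i; rewrite !mxE; ring.
  by move/convex_setP: (convex_closure cD); apply.
suff : K v by [].
rewrite vE; apply: convex_sum => //.
- by rewrite /K /= addr0.
- by move=> i; have [ti _] := Ht i; rewrite divr_ge0// ltW.
- apply: (@le_trans _ _ (C * `|v|)); last first.
    by rewrite mulrC -ler_pdivlMr// mul1r ltW.
  rewrite /C mulrDl mul1r ler_wpDr// mulr_suml ler_sum// => i _.
  have [ti _] := Ht i; have [_ ci] := Hc i.
  by rewrite mulrAC ler_pM2r ?invr_gt0// ci.
- move=> i; have [ti H] := Ht i; apply: H.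
  rewrite normrM (gtr0_norm ti) normr_sg ler_piMl ?(ltW ti)//.
  by case: (u i != 0).
Qed.

(** [nu] vanishes on these directions but is positive on [D - q], so the points of the closure found
    by [lineality_ball] are outside [D]. *)
Lemma lineality_hypersurface D W M q (nu : 'cV[R]_N) (B : 'M[R]_N) :
  open D -> convex_set D -> open W -> M = W `&` boundary D -> M q ->
  (forall d, D d -> 0 < lin nu (d - q)) ->
  (forall v, (v <= B)%MS -> lineality D q v) ->
  exists2 del : R, 0 < del & forall v, (v <= B)%MS -> `|v| < del -> M (q + v).
Proof.
move=> oD cD oW ME Mq Hnu BV.
have cq : closure D q by move: Mq; rewrite ME => -[_ []].
have Wq : W q by move: Mq; rewrite ME => -[].
have [d1 d10 H1] := lineality_ball cD cq BV.
have nW : nbhs q W by exact: open_nbhs_nbhs.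
have [d2 d20 H2] := (@nbhs_addP R E q _).1 nW.
exists (Num.min d1 d2) => [|v vB]; first by rewrite lt_min d10.
rewrite lt_min => /andP[v1 v2]; rewrite ME; split; first exact: H2.
split; first exact: H1.
move=> /interior_subset /Hnu; rewrite addrAC subrr add0r.
by rewrite (lineality_tangent Hnu (BV v vB)) ltxx.
Qed.

End lineality.

(** * The two implications for real planes *)

Section real_case.
Variables (R : realType) (n : nat).
Local Notation E := 'rV[R]_n.+1.
Implicit Types (M O : set E) (q : E).

Lemma gram_entry N m1 m2 (A : 'M[R]_(m1, N)) (G : 'M[R]_N) (T : 'M[R]_(m2, N)) i j :
  (A *m G *m T^T) i j = form G (row i A) (row j T).
Proof.
rewrite /form tr_row -row_mul [LHS]mxE [RHS]mxE; apply: eq_bigr => k _.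
by congr (_ * _); rewrite [RHS]mxE.
Qed.

Lemma plane_second_form_rank M q k (P : set E) : (k < n)%N ->
  convex_hypersurface M -> M q -> affine_plane (n - k) P -> P q ->
  real_locally_lies M q P -> second_form_rank_le M q k.
Proof.
move=> kn cM Mq aP Pq [U nU PM] r rM.
have [A [rA AP]] := affine_plane_direction aP Pq.
have [U' [[oU' Uq'] C2 _ g0]] := rM.
have sH := hessian_sym oU' C2 Uq'.
have flat v : (v <= A)%MS ->
    lin (gradient r q) v = 0 /\ form (hessian r q) v v = 0.
  move=> vA; apply: (flat_direction rM Mq).
  have [del del0 H] := (@nbhs_addP R E q _).1 nU.
  apply/(@nbhs_addP R R); exists (del / (`|v| + 1)) => [|t].
    by rewrite divr_gt0// ltr_wpDl.
  rewrite ltr_pdivlMr ?ltr_wpDl// add0r => td; apply: PM; split.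
    by apply: AP; rewrite scalemx_sub.
  apply: H; rewrite normrZ; apply: le_lt_trans td.
  by rewrite ler_wpM2l// lerDl.
have [lam lam0 Hlam] := tangent_form_semidefinite cM Mq rM.
pose g := gradient r q; pose H := hessian r q; pose T := row_base (kermx g).
have tanP X : (X <= T)%MS -> lin g X = 0.
  by rewrite eq_row_base => /sub_kermxP/lin_eq0.
have AT : (A <= T)%MS.
  rewrite eq_row_base; apply/row_subP => i; apply/sub_kermxP/lin_eq0.
  by have [] := flat _ (row_sub i A).
have null v X : (v <= A)%MS -> lin g X = 0 -> form H v X = 0.
  move=> vA; have [v0 vv] := flat v vA.
  apply: (semidefinite_null sH lam0 Hlam) => // Y t Y0.
  by rewrite /= linD linZ v0 Y0 mulr0 addr0.
rewrite /second_form_rank -/g -/H -/T -mulmxA.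
have AC : A *m (H *m T^T) = 0.
  apply/matrixP => i j; rewrite [RHS]mxE.
  rewrite mulmxA gram_entry.
  exact: null (row i A) (row j T) (row_sub i A) (tanP _ (row_sub j T)).
apply: (leq_trans (mxrank_null_rows AT AC)).
have rT : \rank (kermx g) = n.
  by rewrite mxrank_ker -(mxrank_tr g) rank_rV -trmx0 (inj_eq trmx_inj) g0// subn1.
by rewrite rA rT; lia.
Qed.

Lemma real_flat_plane M q k O : (k < n)%N -> C2_hypersurface M ->
  convex_hypersurface M -> M q -> nbhs q O ->
  (forall x, O x -> M x -> second_form_rank_le M x k) ->
  exists P, [/\ affine_plane (n - k) P, P q & real_locally_lies M q P].
Proof.
move=> kn C2M [D [D0 oD cD [W oW ME]]] Mq nO Hrk.
have cq : closure D q by move: Mq; rewrite ME => -[_ []].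
have [r0 r0M] := C2M q Mq.
have [nu nu0 Hnu] := supporting_hyperplane D0 oD cD oW ME Mq r0M.
have [B BV] := @subspace_mx R n.+1 (lineality D q) (lineality0 cq)
  (fun a u v => @linealityDZ R n.+1 D q a u v cD).
have [dB|dB] := leqP (n - k) (\rank B).
  have [B' [fB' B'B]] := subspace_of_rank dB.
  have [del del0 HM] := lineality_hypersurface oD cD oW ME Mq Hnu (fun v => (BV v).2).
  exists [set x | (x - q <= B')%MS]; split; first exact: affine_plane_through.
    by rewrite /= subrr sub0mx.
  exists (ball q del); first exact: nbhsx_ballx.
  move=> x [/= xB]; rewrite -ball_normE /= => xq.
  rewrite -(subrK q x) addrC; apply: HM; first exact: submx_trans xB B'B.
  by rewrite distrC.
exfalso; pose C := cokermx B; pose L := (B^C)%MS.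
have LP v : (v <= L)%MS -> v != 0 -> 0 < form (C *m C^T) v v.
  move=> vL v0; rewrite form_gram lt_neqAle form1_ge0 andbT eq_sym.
  apply: contra v0 => /eqP/form1_eq0/eqP vC.
  by rewrite -submx0 -(capmx_compl B) sub_capmx vL andbT submxE.
have [c Hc] := dominate_norm (@submx_closed R n.+1 L)
  (fun v t (h : (v <= L)%MS) => scalemx_sub t h) LP.
(* As a form, the identity on the row space of [B], which [C] kills, and negative definite on its
   complement [L]. *)
pose G := 1%:M - c *: (C *m C^T).
have formG v : form G v v = form 1%:M v v - c * form (C *m C^T) v v.
  by rewrite /form mulmxBr mulmxBl -scalemxAr -scalemxAl !mxE.
have HG v (t : R) : 0 < t -> closure D (q + v) -> closure D (q - t *: v) ->
    form 1%:M v v <= form G v v.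
  move=> t0 Dp Dm; rewrite formG form_gram.
  have /BV := lineality_segment cD cq t0 Dp Dm.
  by rewrite submxE -/C => /eqP->; rewrite form0l mulr0 subr0.
have [x [r [Mx Ox rM [lam Hlam]]]] :=
  touching_point oD cD oW ME C2M Mq nu0 Hnu HG nO.
have := Hrk x Ox Mx r rM; rewrite /second_form_rank.
set T := row_base _; rewrite -mulmxA => rk.
(* The tangent space has dimension at least [n], and [L] has dimension at least [k + 2]. *)
have dim : (n.+1 + k < \rank (kermx (gradient r x)) + \rank L)%N.
  rewrite mxrank_ker mxrank_compl.
  by have := rank_leq_col (gradient r x); have := rank_leq_row B; lia.
have [z [z0 zL zT zC]] := null_vector_in_subspace (row_base_free _) rk dim.
have z_tan : lin (gradient r x) z = 0.
  by apply/lin_eq0/sub_kermxP; rewrite eq_row_base in zT.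
have Hz : form (hessian r x) z z = 0.
  rewrite /form; have /submxP[y zE] := zT.
  by rewrite {2}zE trmx_mul mulmxA -(mulmxA z) zC mul0mx mxE.
have := Hlam z z_tan; rewrite Hz mulr0 formG; have := Hc z zL z0; lra.
Qed.

End real_case.

(** * The complex case *)

Section complex_coordinates.
Variables (R : realType) (m : nat).
Local Notation C := R[i].
Local Notation E := 'rV[R]_(m + m).
Implicit Types (w u v : E) (z : 'rV[C]_m).

Lemma coordP w u : (forall j, w 0 (lshift m j) = u 0 (lshift m j)) ->
  (forall j, w 0 (rshift m j) = u 0 (rshift m j)) -> w = u.
Proof.
move=> Hl Hr; rewrite -(hsubmxK w) -(hsubmxK u); congr row_mx.
  by apply/rowP => j; rewrite !mxE.
by apply/rowP => j; rewrite !mxE.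
Qed.


Lemma Re_sum (I : Type) (s : seq I) (f : I -> C) :
  complex.Re (\sum_(i <- s) f i) = \sum_(i <- s) complex.Re (f i).
Proof. by apply: (big_morph (@complex.Re R)) => [[a b] [c d]|]. Qed.

Lemma Im_sum (I : Type) (s : seq I) (f : I -> C) :
  complex.Im (\sum_(i <- s) f i) = \sum_(i <- s) complex.Im (f i).
Proof. by apply: (big_morph (@complex.Im R)) => [[a b] [c d]|]. Qed.

Lemma eqC (x y : C) :
  complex.Re x = complex.Re y -> complex.Im x = complex.Im y -> x = y.
Proof. by case: x y => [a b] [c d] /= -> ->. Qed.

Lemma half_complex (x y : R) : (x +i* y) / 2%:R = (x / 2) +i* (y / 2) :> C.
Proof.
have n2 : (2%:R : C) != 0 by rewrite pnatr_eq0.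
apply: (canLR (mulfK n2)); rewrite mulr_natr mulr2n.
by apply: eqC => /=; field.
Qed.

Definition rvec z : E :=
  row_mx (\row_j complex.Re (z 0 j)) (\row_j complex.Im (z 0 j)).

Lemma rvec_l z j : rvec z 0 (lshift m j) = complex.Re (z 0 j).
Proof. by rewrite row_mxEl mxE. Qed.

Lemma rvec_r z j : rvec z 0 (rshift m j) = complex.Im (z 0 j).
Proof. by rewrite row_mxEr mxE. Qed.

Lemma cvecK w : rvec (cvec w) = w.
Proof.
by apply: coordP => j; rewrite ?rvec_l ?rvec_r mxE.
Qed.

Lemma rvecK z : cvec (rvec z) = z.
Proof.
by apply/rowP => j; rewrite mxE rvec_l rvec_r; case: (z 0 j).
Qed.

(* Multiplication by i in the coordinates (x, y) of x + i y. *)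
Definition Jmx : 'M[R]_(m + m) := block_mx 0 1%:M (- 1%:M) 0.

Lemma rvecJ_l z j : (rvec z *m Jmx) 0 (lshift m j) = - complex.Im (z 0 j).
Proof.
by rewrite mul_row_block !mulmx0 add0r mulmxN mulmx1 row_mxEl !mxE.
Qed.

Lemma rvecJ_r z j : (rvec z *m Jmx) 0 (rshift m j) = complex.Re (z 0 j).
Proof. by rewrite mul_row_block !mulmx0 addr0 mulmx1 row_mxEr mxE. Qed.

Lemma rvecD z z' : rvec (z + z') = rvec z + rvec z'.
Proof.
apply: coordP => j; rewrite [RHS]mxE !(rvec_l, rvec_r) mxE;
  by case: (z 0 j) (z' 0 j) => [a b] [c d].
Qed.

Lemma rvecZ (c : C) z :
  rvec (c *: z) = complex.Re c *: rvec z + complex.Im c *: (rvec z *m Jmx).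
Proof.
apply: coordP => j; rewrite [RHS]mxE ?[(_ *: rvec z) _ _]mxE
  ?[(_ *: (rvec z *m Jmx)) _ _]mxE ?rvec_l ?rvec_r ?rvecJ_l ?rvecJ_r mxE;
  by case: c (z 0 j) => [a b] [x y] /=; ring.
Qed.

Lemma rvec0 : rvec 0 = 0.
Proof. by apply: coordP => j; rewrite [RHS]mxE !(rvec_l, rvec_r) mxE. Qed.

Lemma rvec_eq0 z : rvec z = 0 -> z = 0.
Proof. by move=> z0; rewrite -(rvecK z) z0 -rvec0 rvecK. Qed.

Lemma rvecJ z : rvec z *m Jmx = rvec ('i *: z).
Proof. by rewrite rvecZ /= scale0r scale1r add0r. Qed.

Lemma JmxK w : w *m Jmx *m Jmx = - w.
Proof.
rewrite -(cvecK w) rvecJ rvecJ; set z := cvec w.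
have -> : 'i *: ('i *: z) = - z.
  by rewrite scalerA -scaleN1r; congr (_ *: _); apply: eqC => /=; ring.
by apply: coordP => j; rewrite [RHS]mxE !(rvec_l, rvec_r) mxE; case: (z 0 j).
Qed.

Lemma cvecD w u : cvec (w + u) = cvec w + cvec u.
Proof. by rewrite -{1}(cvecK w) -{1}(cvecK u) -rvecD rvecK. Qed.

Lemma cvecZ (t : R) w : cvec (t *: w) = t%:C *: cvec w.
Proof.
rewrite -[RHS]rvecK rvecZ /= scale0r addr0 cvecK //.
Qed.

Lemma form1J w : form 1%:M (w *m Jmx) (w *m Jmx) = form 1%:M w w.
Proof.
rewrite !form1E -(cvecK w) !big_split_ord /= addrC; congr (_ + _);
  apply: eq_bigr => j _; rewrite ?rvecJ_l ?rvecJ_r ?rvec_l ?rvec_r //.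
by rewrite sqrrN.
Qed.

Lemma linJ_split (l : 'cV[R]_(m + m)) z :
  lin l (rvec z) = \sum_j (complex.Re (z 0 j) * l (lshift m j) 0 +
                           complex.Im (z 0 j) * l (rshift m j) 0) /\
  lin l (rvec z *m Jmx) = \sum_j (- complex.Im (z 0 j) * l (lshift m j) 0 +
                           complex.Re (z 0 j) * l (rshift m j) 0).
Proof.
split; rewrite linE big_split_ord /= -big_split /=; apply: eq_bigr => j _.
  by rewrite rvec_l rvec_r.
by rewrite rvecJ_l rvecJ_r.
Qed.

Lemma form_split (H : 'M[R]_(m + m)) w u : form H w u = \sum_i \sum_j
  (w 0 (lshift m i) * H (lshift m i) (lshift m j) * u 0 (lshift m j) +
   w 0 (lshift m i) * H (lshift m i) (rshift m j) * u 0 (rshift m j) +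
   (w 0 (rshift m i) * H (rshift m i) (lshift m j) * u 0 (lshift m j) +
   w 0 (rshift m i) * H (rshift m i) (rshift m j) * u 0 (rshift m j))).
Proof.
rewrite formE big_split_ord /= -big_split /=; apply: eq_bigr => i _.
rewrite !big_split_ord /= -!big_split /= !mulr_sumr -big_split /=.
by apply: eq_bigr => j _; rewrite !mulrDr !mulrA.
Qed.

(** Twice the part of [H] invariant under multiplication by i, which is what the Levi form sees. *)
Definition hermitian_part (H : 'M[R]_(m + m)) := H + Jmx *m H *m Jmx^T.

Lemma hermitian_partE H w u :
  form (hermitian_part H) w u = form H w u + form H (w *m Jmx) (u *m Jmx).
Proof. by rewrite /form mulmxDr mulmxDl mxE trmx_mul !mulmxA. Qed.

Lemma hermitian_part_sym H : H^T = H -> (hermitian_part H)^T = hermitian_part H.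
Proof. by move=> sH; rewrite /hermitian_part linearD /= !trmx_mul trmxK sH mulmxA. Qed.

End complex_coordinates.

(** * The Levi form in real coordinates *)

Section levi.
Variables (R : realType) (m : nat).
Local Notation C := R[i].
Local Notation E := 'rV[R]_(m + m).
Implicit Types (w u v q : E) (z : 'rV[C]_m) (r : E -> R).

Lemma partial_cst0 (i : 'I_(m + m)) : partial i (fun _ : E => 0 : R) = fun=> 0.
Proof. by apply/funext => w; exact: derive_cst. Qed.

Lemma cpartial_real i r w : cpartial i (fun u => (r u)%:C) w = partial i r w +i* 0.
Proof. by rewrite /cpartial /= partial_cst0. Qed.

Lemma dzbar_real j r w : dzbar j (fun u => (r u)%:C) w =
  (partial (lshift m j) r w / 2) +i* (partial (rshift m j) r w / 2).
Proof.
rewrite /dzbar !cpartial_real -half_complex; congr (_ / _).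
by apply: eqC => /=; ring.
Qed.

Lemma dz_real j r w : dz j (fun u => (r u)%:C) w =
  (partial (lshift m j) r w / 2) +i* (- partial (rshift m j) r w / 2).
Proof.
rewrite /dz !cpartial_real -half_complex; congr (_ / _).
by apply: eqC => /=; ring.
Qed.

Lemma partial_half i (f : E -> R) q : derivable f q (evec R i) ->
  partial i (fun u : E => f u / 2) q = partial i f q / 2.
Proof.
by move=> df; rewrite mulrC -deriveMr.
Qed.

Lemma levi_mxE U r q i j : C2_on U r -> U q -> levi_mx r q i j =
  ((hessian r q (lshift m i) (lshift m j) +
    hessian r q (rshift m i) (rshift m j)) / 4%:R) +i*
  ((hessian r q (lshift m i) (rshift m j) -
    hessian r q (rshift m i) (lshift m j)) / 4%:R).
Proof.
move=> [_ C2] Uq; rewrite mxE.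
have -> : dzbar j (fun u => (r u)%:C) = fun u =>
    (partial (lshift m j) r u / 2) +i* (partial (rshift m j) r u / 2).
  by apply/funext => u; exact: dzbar_real.
have D a b : derivable (partial a r) q (evec R b) by have [_ /(_ b)[]] := C2 a q Uq.
rewrite /dz /cpartial /= !partial_half// !mxE.
set a1 := partial _ _ _; set a2 := partial _ _ _.
set a3 := partial _ _ _; set a4 := partial _ _ _.
rewrite (_ : _ - _ = ((a1 + a4) / 2) +i* ((a2 - a3) / 2)).
  by rewrite half_complex; apply: eqC => /=; field.
by apply: eqC => /=; field.
Qed.

(** The real and imaginary parts of [z *m cgradient r q] are, up to the factors 1/2 and -1/2, the
    real gradient on [z] and on [i z]: the complex tangent space is the real one intersected with
    its image under i. *)
Lemma cgradient_tangent r q z : (z *m cgradient r q = 0) <->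
  (lin (gradient r q) (rvec z) = 0 /\ lin (gradient r q) (rvec z *m Jmx R m) = 0).
Proof.
set g := gradient r q; have [l1 l2] := linJ_split g z.
have E1 : (z *m cgradient r q) 0 0 =
    (lin g (rvec z) / 2) +i* (- lin g (rvec z *m Jmx R m) / 2).
  rewrite mxE l1 l2 -sumrN !mulr_suml.
  apply: eqC; rewrite ?Re_sum ?Im_sum /=; apply: eq_bigr => j _;
    by rewrite mxE dz_real /g !mxE; case: (z 0 j) => a b /=; field.
split=> [z0|[h1 h2]].
  move: E1; rewrite z0 mxE => -[h1 h2]; split; lra.
apply/matrixP => i j; rewrite !ord1 E1 h1 h2 oppr0 mul0r mxE.
by apply: eqC.
Qed.

(** The imaginary part of a Hermitian form is its real part with one argument multiplied by i. The 4
    comes from the factors 1/2 in [dz] and [dzbar]. *)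
Lemma levi_formE U r q z z' : C2_on U r -> U q ->
  (z *m levi_mx r q *m (map_mx conjc z')^T) 0 0 =
  (form (hermitian_part (hessian r q)) (rvec z) (rvec z') / 4%:R) +i*
  (form (hermitian_part (hessian r q)) (rvec z) (rvec z' *m Jmx R m) / 4%:R).
Proof.
move=> C2 Uq; rewrite !hermitian_partE JmxK formNr.
set H := hessian r q.
rewrite !form_split -!sumrN -!big_split /= !mulr_suml.
rewrite -mulmxA mxE.
have E1 i : z 0 i * (levi_mx r q *m (map_mx conjc z')^T) i 0 =
    \sum_j z 0 i * (levi_mx r q i j * conjc (z' 0 j)).
  rewrite mxE mulr_sumr; apply: eq_bigr => j _; congr (_ * (_ * _)).
  by rewrite mxE mxE.
rewrite (eq_bigr _ (fun i _ => E1 i)).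
apply: eqC; rewrite ?Re_sum ?Im_sum; apply: eq_bigr => i _;
  rewrite ?Re_sum ?Im_sum -?sumrN -!big_split /= mulr_suml; apply: eq_bigr => j _;
  by rewrite (levi_mxE _ _ C2 Uq) -/H ?rvec_l ?rvec_r ?rvecJ_l ?rvecJ_r;
  case: (z 0 i) (z' 0 j) => [a b] [c d] /=; field.
Qed.

Lemma cgradient_neq0 r q : gradient r q != 0 -> cgradient r q != 0.
Proof.
apply: contra => /eqP g0; apply/eqP/trmx_inj/coordP => j; rewrite !mxE;
  by have /colP/(_ j) := g0; rewrite !mxE dz_real => -[h1 h2]; lra.
Qed.

End levi.

(** * The two implications for complex planes *)

Section complex_case.
Variables (R : realType) (n : nat).
Local Notation C := R[i].
Local Notation E := 'rV[R]_(n.+1 + n.+1).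
Local Notation J := (Jmx R n.+1).
Implicit Types (M O : set E) (q w : E) (z : 'rV[C]_n.+1).

Lemma plane_levi_rank M q k (P : set 'rV[C]_n.+1) : (k < n)%N ->
  convex_hypersurface M -> M q -> affine_plane (n - k) P -> P (cvec q) ->
  complex_locally_lies M q P -> levi_rank_le M q k.
Proof.
move=> kn cM Mq aP Pq [U nU PM] r rM.
have [A [rA AP]] := affine_plane_direction aP Pq.
have [U' [[oU' Uq'] C2 _ g0]] := rM.
pose g := gradient r q; pose H := hessian r q.
have sH : H^T = H := hessian_sym oU' C2 Uq'.
have flat z : (z <= A)%MS -> lin g (rvec z) = 0 /\ form H (rvec z) (rvec z) = 0.
  move=> zA; apply: (flat_direction rM Mq).
  have [del del0 Hdel] := (@nbhs_addP R E q _).1 nU.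
  apply/(@nbhs_addP R R); exists (del / (`|rvec z| + 1)) => [|t].
    by rewrite divr_gt0// ltr_wpDl.
  rewrite ltr_pdivlMr ?ltr_wpDl// add0r => td; apply: PM; split.
    by rewrite /= cvecD cvecZ rvecK; apply: AP; rewrite scalemx_sub.
  apply: Hdel; rewrite normrZ; apply: le_lt_trans td.
  by rewrite ler_wpM2l// lerDl.
(* The row space of [A] is complex, so it contains [i z] with [z]. *)
have flatJ z : (z <= A)%MS ->
    lin g (rvec z *m J) = 0 /\ form H (rvec z *m J) (rvec z *m J) = 0.
  by move=> zA; rewrite rvecJ; apply: flat; rewrite scalemx_sub.
have [lam lam0 Hlam] := tangent_form_semidefinite cM Mq rM.
pose TC := [set w : E | lin g w = 0 /\ lin g (w *m J) = 0].
have Hpos w : TC w -> 0 <= lam * form (hermitian_part H) w w.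
  by move=> [w1 w2]; rewrite hermitian_partE mulrDr addr_ge0// Hlam.
pose T := row_base (kermx (cgradient r q)).
have tanP z : (z <= T)%MS -> TC (rvec z).
  by rewrite eq_row_base => /sub_kermxP/cgradient_tangent.
have AT : (A <= T)%MS.
  rewrite eq_row_base; apply/row_subP => i; apply/sub_kermxP/cgradient_tangent.
  by split; [have [] := flat _ (row_sub i A) | have [] := flatJ _ (row_sub i A)].
have null z w : (z <= A)%MS -> TC w -> form (hermitian_part H) (rvec z) w = 0.
  move=> zA; have [z0 zz] := flat z zA; have [zJ0 zzJ] := flatJ z zA.
  apply: (semidefinite_null (hermitian_part_sym sH) lam0 Hpos).
    by move=> X t [X0 XJ]; split; rewrite ?mulmxDl ?linD -?scalemxAl linZ ?z0 ?zJ0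
      ?X0 ?XJ mulr0 addr0.
  by rewrite hermitian_partE zz zzJ addr0.
rewrite /levi_rank -/T -mulmxA.
have AC : A *m (levi_mx r q *m (map_mx conjc T)^T) = 0.
  apply/matrixP => i j; rewrite [RHS]mxE mulmxA.
  have -> : (A *m levi_mx r q *m (map_mx conjc T)^T) i j =
     (row i A *m levi_mx r q *m (map_mx conjc (row j T))^T) 0 0.
    rewrite map_row tr_row -row_mul [LHS]mxE [RHS]mxE; apply: eq_bigr => l _.
    by congr (_ * _); rewrite [RHS]mxE.
  rewrite (levi_formE _ _ C2 Uq').
  have [t1 t2] := tanP _ (row_sub j T).
  rewrite (null _ _ (row_sub i A)) ?(null _ _ (row_sub i A)) ?mul0r//.
  (* [TC] is stable under [J], which settles the imaginary part of the entry. *)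
  by split=> //; rewrite JmxK linN t1 oppr0.
apply: (leq_trans (mxrank_null_rows AT AC)).
have rT : \rank (kermx (cgradient r q)) = n.
  rewrite mxrank_ker -(mxrank_tr (cgradient r q)) rank_rV -trmx0 (inj_eq trmx_inj).
  by rewrite cgradient_neq0 ?subn1// g0.
by rewrite rA rT; lia.
Qed.

Lemma complex_flat_plane M q k O : (k < n)%N -> C2_hypersurface M ->
  convex_hypersurface M -> M q -> nbhs q O ->
  (forall x, O x -> M x -> levi_rank_le M x k) ->
  exists P, [/\ affine_plane (n - k) P, P (cvec q) & complex_locally_lies M q P].
Proof.
move=> kn C2M [D [D0 oD cD [W oW ME]]] Mq nO Hrk.
have cq : closure D q by move: Mq; rewrite ME => -[_ []].
have [r0 r0M] := C2M q Mq.
have [nu nu0 Hnu] := supporting_hyperplane D0 oD cD oW ME Mq r0M.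
pose V := lineality D q.
have V0 : V 0 := lineality0 cq.
have VDZ a u v : V u -> V v -> V (a *: u + v) by exact: linealityDZ.
have [B BV] := subspace_mx V0 VDZ.
(* The largest complex subspace inside [V]. *)
pose VC := [set z | V (rvec z) /\ V (rvec z *m J)].
have VC0 : VC 0 by split; rewrite rvec0 ?mul0mx.
have VDZ2 (a b : R) u v w : V u -> V v -> V w -> V (a *: u + b *: v + w).
  by move=> Vu Vv Vw; rewrite -addrA; exact: VDZ Vu (VDZ b v w Vv Vw).
have VCDZ a u v : VC u -> VC v -> VC (a *: u + v).
  move=> [u1 u2] [v1 v2]; rewrite /VC /mkset rvecD rvecZ; split.
    exact: VDZ2 u1 u2 v1.
  rewrite mulmxDl (mulmxDl (_ *: _)) -!scalemxAl JmxK scalerN -scaleNr.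
  exact: VDZ2 u2 u1 v2.
have [BC BCV] := subspace_mx VC0 VCDZ.
have [dB|dB] := leqP (n - k) (\rank BC).
  have [B' [fB' B'B]] := subspace_of_rank dB.
  have [del del0 HM] := lineality_hypersurface oD cD oW ME Mq Hnu (fun v => (BV v).2).
  exists [set x | (x - cvec q <= B')%MS]; split; first exact: affine_plane_through.
    by rewrite /= subrr sub0mx.
  exists (ball q del); first exact: nbhsx_ballx.
  move=> x [/= xB]; rewrite -ball_normE /= => xq.
  rewrite -(subrK q x) addrC; apply: HM; last by rewrite distrC.
  apply/BV; have : (cvec (x - q) <= BC)%MS.
    have -> : cvec (x - q) = cvec x - cvec q.
      by apply: (addIr (cvec q)); rewrite -cvecD !subrK.
    exact: submx_trans xB B'B.
  by move=> /BCV[]; rewrite cvecK.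
exfalso; pose Cm := cokermx B; pose LC := (BC^C)%MS.
have [L LE] : exists L : 'M[R]_(n.+1 + n.+1), forall w, (cvec w <= LC)%MS <-> (w <= L)%MS.
  apply: subspace_mx.
    have -> : cvec (0 : E) = 0 by rewrite -rvec0 rvecK.
    exact: sub0mx.
  by move=> a u v uL vL; rewrite cvecD cvecZ addmx_sub// scalemx_sub.
(* [V] is the kernel of [Cm], so [form Pm w w] vanishes only if both [w] and [J w] are in [V]. *)
pose Pm := hermitian_part (Cm *m Cm^T).
have PmE w : form Pm w w =
    form 1%:M (w *m Cm) (w *m Cm) + form 1%:M (w *m J *m Cm) (w *m J *m Cm).
  by rewrite hermitian_partE !form_gram.
have LP v : (v <= L)%MS -> v != 0 -> 0 < form Pm v v.
  move=> /LE vL v0; rewrite lt_neqAle PmE addr_ge0 ?form1_ge0// andbT eq_sym.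
  apply: contra v0; rewrite paddr_eq0 ?form1_ge0//.
  move=> /andP[/eqP/form1_eq0 h1 /eqP/form1_eq0 h2].
  have Vv : V v by apply/BV; rewrite submxE -/Cm h1.
  have VJ : V (v *m J) by apply/BV; rewrite submxE -/Cm h2.
  have vB : (cvec v <= BC)%MS by apply/BCV; rewrite /VC /= cvecK.
  have /eqP cv0 : cvec v == 0.
    by rewrite -submx0 -(capmx_compl BC) sub_capmx vL vB.
  by rewrite -(cvecK v) cv0 rvec0.
have [c Hc] := dominate_norm (@submx_closed R _ L)
  (fun v t (h : (v <= L)%MS) => scalemx_sub t h) LP.
(* [G] has to be the identity on all of [V], hence [Cm *m Cm^T] and not [Pm]; averaging over [J] is
   postponed to the touching point. There it doubles the identity, whence [2%:R * c]. *)
pose G := 1%:M - (2%:R * c) *: (Cm *m Cm^T).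
have formG v : form G v v = form 1%:M v v - 2%:R * c * form (Cm *m Cm^T) v v.
  by rewrite /form mulmxBr mulmxBl -scalemxAr -scalemxAl !mxE.
have HG v (t : R) : 0 < t -> closure D (q + v) -> closure D (q - t *: v) ->
    form 1%:M v v <= form G v v.
  move=> t0 Dp Dm; rewrite formG form_gram.
  have /BV := lineality_segment cD cq t0 Dp Dm.
  by rewrite submxE -/Cm => /eqP->; rewrite form0l mulr0 subr0.
have [x [r [Mx Ox rM [lam Hlam]]]] :=
  touching_point oD cD oW ME C2M Mq nu0 Hnu HG nO.
have [U [[oU Ux] C2 _ _]] := rM.
have := Hrk x Ox Mx r rM; rewrite /levi_rank.
set T := row_base _; rewrite -mulmxA => rk.
have dim : (n.+1 + k < \rank (kermx (cgradient r x)) + \rank LC)%N.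
  rewrite mxrank_ker mxrank_compl.
  by have := rank_leq_col (cgradient r x); have := rank_leq_row BC; lia.
have [z [z0 zL zT zC]] := null_vector_in_subspace (row_base_free _) rk dim.
have [t1 t2] : lin (gradient r x) (rvec z) = 0 /\
    lin (gradient r x) (rvec z *m J) = 0.
  by apply/cgradient_tangent/sub_kermxP; rewrite eq_row_base in zT.
have := levi_formE z z C2 Ux.
have -> : (z *m levi_mx r x *m (map_mx conjc z)^T) 0 0 = 0.
  have /submxP[y zE] := zT.
  by rewrite {2}zE map_mxM trmx_mul mulmxA -(mulmxA z) zC mul0mx mxE.
move=> /(congr1 (@complex.Re R)) /=; rewrite hermitian_partE => Hz.
have wL : (rvec z <= L)%MS by apply/LE; rewrite rvecK.
have w0 : rvec z != 0 by apply: contra z0 => /eqP/rvec_eq0->.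
have := Hc _ wL w0; rewrite PmE => Hcz.
(* The second order inequalities at [z] and [i z] add up to [c * form Pm w w <= form 1%:M w w] for
   [w = rvec z], against [Hcz]. *)
have := Hlam _ t1; have := Hlam _ t2; rewrite !formG form1J !form_gram => h1 h2.
have : lam * (form (hessian r x) (rvec z) (rvec z) +
    form (hessian r x) (rvec z *m J) (rvec z *m J)) = 0.
  by rewrite -[RHS](mulr0 lam); congr (_ * _); lra.
by rewrite mulrDr; lra.
Qed.

End complex_case.

Theorem proposition1 (R : realType) (n k : nat)
    (hn : (1 <= n)%N) (hk : (k < n)%N) :
  (forall (M : set 'rV[R]_n.+1) (p : 'rV[R]_n.+1),
     C2_hypersurface M -> convex_hypersurface M -> M p ->
     ((\forall q \near within M (nbhs p), second_form_rank_le M q k) <->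
      (\forall q \near within M (nbhs p),
         exists P : set 'rV[R]_n.+1,
           [/\ affine_plane (n - k) P, P q & real_locally_lies M q P])))
  /\
  (forall (M : set 'rV[R]_(n.+1 + n.+1)) (p : 'rV[R]_(n.+1 + n.+1)),
     C2_hypersurface M -> convex_hypersurface M -> M p ->
     ((\forall q \near within M (nbhs p), levi_rank_le M q k) <->
      (\forall q \near within M (nbhs p),
         exists P : set 'rV[R[i]]_n.+1,
           [/\ affine_plane (n - k) P, P (cvec q)
             & complex_locally_lies M q P]))).
Proof.
split=> M p C2M cM Mp; split.
(* The touching point may differ from [q], so the rank bound is required on a neighbourhood of each
   [q]; passing to the interior provides it. The converse is pointwise. *)
- rewrite !near_withinE => /nbhs_interior; apply: filterS => q nq Mq.
  apply: (@real_flat_plane _ _ M q k _ hk C2M cM Mq nq).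
  by move=> x Hx Mx; exact: Hx.
- rewrite !near_withinE; apply: filterS => q H Mq.
  by have [P [aP Pq PM]] := H Mq; exact: plane_second_form_rank PM.
- rewrite !near_withinE => /nbhs_interior; apply: filterS => q nq Mq.
  apply: (@complex_flat_plane _ _ M q k _ hk C2M cM Mq nq).
  by move=> x Hx Mx; exact: Hx.
- rewrite !near_withinE; apply: filterS => q H Mq.
  by have [P [aP Pq PM]] := H Mq; exact: plane_levi_rank PM.
Qed.
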